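(* Let $\mathcal{M}=\{M^x:x\in\Lambda\}$ be a standard log-convex weight matrix, and let $U\subseteq\mathbb{R}^r$ be non-empty open. (Roumieu case) Assume that (i) for all $C>0$ and $x\in\Lambda$ there exist $D>0$, $y\in\Lambda$ with $C^kM^x_k\le DM^y_k$ for all $k\in\mathbb{N}$; (ii) for all $x\in\Lambda$ there exist $C>0$, $y_1,y_2\in\Lambda$ with $M^x_{j+k}\le C^{j+k}M^{y_1}_jM^{y_2}_k$ for all $j,k\in\mathbb{N}$; (iii) $\mathcal{E}_{\{\mathcal{M}\}}$ is non-quasianalytic. Then $\mathcal{D}_{\{\mathcal{M}\}}(U)=\mathcal{D}_{\{\omega_{\mathcal{M}}\}}(U)=\hat{\mathcal{D}}_{\{\omega_{\mathcal{M}}\}}(U)$. (Beurling case) Assume that (i) for all $C>0$ and $x\in\Lambda$ there exist $D>0$, $y\in\Lambda$ with $C^kM^y_k\le DM^x_k$ for all $k\in\mathbb{N}$; (ii) for all $x_1,x_2\in\Lambda$ there exist $C>0$, $y\in\Lambda$ with $M^y_{j+k}\le C^{j+k}M^{x_1}_jM^{x_2}_k$ for all $j,k\in\mathbb{N}$; (iii) $\mathcal{E}_{(\mathcal{M})}$ is non-quasianalytic. Then $\mathcal{D}_{(\mathcal{M})}(U)=\mathcal{D}_{(\omega_{\mathcal{M}})}(U)=\hat{\mathcal{D}}_{(\omega_{\mathcal{M}})}(U)$.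
   Context: $\mathbb{N}=\{0,1,2,\dots\}$. $\mathcal{LC}$ is the set of sequences $M=(M_k)_{k\in\mathbb{N}}$ of positive reals with $1=M_0\le M_1$, $M_j^2\le M_{j-1}M_{j+1}$ for all $j\ge1$, and $\lim_{k\to\infty}(M_k)^{1/k}=+\infty$. $(\Lambda,\le)$ is a partially ordered set which is both upward and downward directed. A standard log-convex weight matrix is a family $\mathcal{M}=\{M^x:x\in\Lambda\}\subset\mathcal{LC}$ with $M^x\le M^y$ (termwise) for $x\le y$. Associated function: $\omega_M(t):=\sup_{p\in\mathbb{N}}\log(t^p/M_p)$ for $t>0$, $\omega_M(0):=0$; for a vector $t$ put $\omega_M(t):=\omega_M(|t|)$. Put $\varphi_{\omega}(y):=\omega(e^y)$, $\varphi^*_\omega(x):=\sup\{xy-\varphi_\omega(y):y\ge0\}$. Functions are smooth and complex-valued on $\mathbb{R}^r$; $f^{(k)}$ is the $k$-th Fréchet derivative with the operator norm, and for $A\subseteq\mathbb{R}^r$ $$\|f\|_{M,A,h}:=\sup_{k\in\mathbb{N},x\in A}\frac{\|f^{(k)}(x)\|}{h^kM_k},\qquad \|f\|_{\omega,A,l}:=\sup_{k\in\mathbb{N},x\in A}\frac{\|f^{(k)}(x)\|}{\exp(\frac1l\varphi^*_\omega(lk))}.$$ $\mathcal{E}_{\{\mathcal{M}\}}(\mathbb{R}^r)$ (resp. $\mathcal{E}_{(\mathcal{M})}(\mathbb{R}^r)$) is the set of smooth $f$ such that for every compact $K$, $\|f\|_{M^x,K,h}<\infty$ for some (resp. all) $x\in\Lambda$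 and $h>0$; the class is non-quasianalytic if it contains a non-zero function with compact support. $\mathcal{D}_{\{\mathcal{M}\}}(U)$ (resp. $\mathcal{D}_{(\mathcal{M})}(U)$) is the set of smooth $f$ on $\mathbb{R}^r$ whose support is contained in some compact $K\subset U$ and with $\|f\|_{M^x,\mathbb{R}^r,h}<\infty$ for some $x\in\Lambda$, $h>0$ (resp. for all $x\in\Lambda$, $h>0$). $\mathcal{D}_{\{\omega_{\mathcal{M}}\}}(U)$ (resp. $\mathcal{D}_{(\omega_{\mathcal{M}})}(U)$) is defined in the same way with $\|f\|_{\omega_{M^x},\mathbb{R}^r,l}$, $l>0$, in place of $\|f\|_{M^x,\mathbb{R}^r,h}$. With $\hat f(t)=\int_{\mathbb{R}^r}f(s)e^{-i\langle s,t\rangle}ds$ and $\|f\|^{\hat{}}_{x,h}:=\int_{\mathbb{R}^r}|\hat f(t)|\exp(h\,\omega_{M^x}(t))\,dt$, the set $\hat{\mathcal{D}}_{\{\omega_{\mathcal{M}}\}}(U)$ (resp. $\hat{\mathcal{D}}_{(\omega_{\mathcal{M}})}(U)$) consists of the smooth $f$ on $\mathbb{R}^r$ with support contained in some compact $K\subset U$ and with $\|f\|^{\hat{}}_{x,h}<\infty$ for some $x\in\Lambda$, $h>0$ (resp. for all $x\in\Lambda$, $h>0$). *)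

(* Defs.v *)
From HB Require Import structures.
From mathcomp Require Import all_boot all_order all_algebra.
From mathcomp Require Import complex.
From mathcomp Require Import all_classical all_reals all_analysis.

Set Implicit Arguments.
Unset Strict Implicit.
Unset Printing Implicit Defensive.

Import Order.TTheory GRing.Theory Num.Theory.
Import numFieldNormedType.Exports.

Local Open Scope classical_set_scope.
Local Open Scope ring_scope.

(* The complex numbers as a normed space over R, so that the library's Fréchet
   differential applies to complex-valued functions.  [Rcomplex R] is the
   alias of [R[i]] whose norm [`|z| : R] is the usual modulus. *)
Section RcomplexNormedModule.
Variable R : realType.

HB.instance Definition _ :=
  PseudoMetric.copy (Rcomplex R) (pseudoMetric_normed (Rcomplex R)).
HB.instance Definition _ := isPointed.Build (Rcomplex R) 0.
HB.instance Definition _ :=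
  NormedZmod_PseudoMetric_eq.Build R (Rcomplex R) erefl.

Lemma Rcomplex_normrZ (l : R) (z : Rcomplex R) : `|l *: z| = `|l| * `|z|.
Proof.
case: z => a b; rewrite /GRing.scale/= /Num.norm/= /Normc.normc/=.
by rewrite !exprMn -mulrDr sqrtrM ?sqr_ge0// sqrtr_sqr.
Qed.

HB.instance Definition _ :=
  PseudoMetricNormedZmod_Lmodule_isNormedModule.Build R (Rcomplex R)
    Rcomplex_normrZ.

End RcomplexNormedModule.

(* Lebesgue measure on R^n, as the n-fold product of [lebesgue_measure].  The
   library has a product sigma-algebra on tuples but none on row vectors;
   [rowv] transports tuples to row vectors. *)
Section LebesgueTuple.
Variable R : realType.
Let T := measurableTypeR R.

Definition tuple_cons (n : nat) (p : n.-tuple T * T) : n.+1.-tuple T :=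
  [tuple of p.2 :: p.1].

Lemma measurable_tuple_cons (n : nat) :
  measurable_fun [set: n.-tuple T * T] (@tuple_cons n).
Proof. exact: measurable_cons. Qed.

Definition lebesgue_tuple_succ (n : nat)
    (m : {measure set (n.-tuple T) -> \bar R}) :
  {measure set (n.+1.-tuple T) -> \bar R}.
Proof.
refine (pushforward (product_measure1 m (@lebesgue_measure R)) (@tuple_cons n)
        : {measure set _ -> \bar R}).
exact: measurable_tuple_cons.
Defined.

Fixpoint lebesgue_tuple (n : nat) : {measure set (n.-tuple T) -> \bar R} :=
  match n with
  | 0 => dirac ([tuple] : 0.-tuple T)
  | n'.+1 => lebesgue_tuple_succ (lebesgue_tuple n')
  end.

Definition rowv (n : nat) (s : n.-tuple T) : 'rV[R]_n := \row_i tnth s i.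

End LebesgueTuple.

Section WeightMatrices.
Variable R : realType.
Implicit Type M : nat -> R.

Definition LC M : Prop :=
  [/\ forall k, 0 < M k,
      M 0%N = 1 /\ 1 <= M 1%N,
      forall j, (1 <= j)%N -> M j ^+ 2 <= M j.-1 * M j.+1 &
      (fun k => M k `^ k%:R^-1) @ \oo --> +oo].

Definition standard_weight_matrix (d : Order.disp_t) (L : porderType d)
    (M : L -> nat -> R) : Prop :=
  [/\ forall x y : L, exists z : L, (x <= z)%O /\ (y <= z)%O,
      forall x y : L, exists z : L, (z <= x)%O /\ (z <= y)%O,
      forall x, LC (M x) &
      forall x y : L, (x <= y)%O -> forall k, M x k <= M y k].

(* Both suprema below are finite when M is in LC: M_k^(1/k) --> +oo bounds
   [log (t^p / M_p)] in p, and makes [omega M (e^y)] grow faster than any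
   multiple of y. *)
Definition omega M (t : R) : R :=
  if t == 0 then 0 else sup (range (fun p : nat => ln (t ^+ p / M p))).

Definition phi (w : R -> R) (y : R) : R := w (expR y).

Definition phi_star (w : R -> R) (x : R) : R :=
  sup [set x * y - phi w y | y in [set y : R | 0 <= y]].

End WeightMatrices.

Section SmoothFunctions.
Variables (R : realType) (r : nat).
Local Notation E := 'rV[R]_r.
Local Notation C := (Rcomplex R).
Implicit Types (f : E -> C) (M : nat -> R) (U A : set E).

(* The library's norm on 'rV[R]_r is the sup norm (with the same topology). *)
Definition dotr (s t : E) : R := \sum_i s ord0 i * t ord0 i.

Definition enorm (t : E) : R := Num.sqrt (dotr t t).

(* [frechet f [:: v1; ..; vk] x] is f^(k)(x)(v1, .., vk):
   f^(k+1)(x)(v, v1, .., vk) is the differential at x, applied to v, of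
   y |-> f^(k)(y)(v1, .., vk).  The k-linear maps on R^r form a
   finite-dimensional space on which evaluations are coordinates, so f^(k) is
   Fréchet differentiable if and only if all its evaluations are. *)
Fixpoint frechet f (vs : seq E) : E -> C :=
  match vs with
  | [::] => f
  | v :: vs' => fun x => 'd (frechet f vs') x v
  end.

Definition smooth f : Prop :=
  forall (vs : seq E) (x : E), differentiable (frechet f vs) x.

(* The operator norm of f^(k)(x), for the Euclidean norm on R^r. *)
Definition opnorm f (k : nat) (x : E) : \bar R :=
  ereal_sup [set (`|frechet f vs x| : R)%:E |
             vs in [set vs : k.-tuple E | forall i, enorm (tnth vs i) <= 1]].

Definition wnorm (W : nat -> R) A f : \bar R :=
  ereal_sup [set (opnorm f k x * ((W k)^-1)%:E)%E | k in [set: nat] & x in A].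

Definition normM M A (h : R) f : \bar R :=
  wnorm (fun k => h ^+ k * M k) A f.

Definition normomega (w : R -> R) A (l : R) f : \bar R :=
  wnorm (fun k => expR (l^-1 * phi_star w (l * k%:R))) A f.

Definition supp f : set E := closure [set x | f x != 0].

Definition Cint (g : r.-tuple (measurableTypeR R) -> C) : C :=
  Complex (\int[lebesgue_tuple R r]_s (complex.Re (g s)))
          (\int[lebesgue_tuple R r]_s (complex.Im (g s))).

(* e^(- i a) = cos a - i sin a. *)
Definition expNi (a : R) : C := Complex (cos a) (- sin a).

Definition fourier f (t : E) : C :=
  Cint (fun s => f (rowv s) * expNi (dotr (rowv s) t)).

Definition normhat M (h : R) f : \bar R :=
  (\int[lebesgue_tuple R r]_t
     ((`|fourier f (rowv t)| : R) * expR (h * omega M (enorm (rowv t))))%:E)%E.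

Definition nonquasianalytic (F : set (E -> C)) : Prop :=
  exists f, [/\ F f, exists x, f x != 0 & compact (supp f)].

Definition test_functions U : set (E -> C) :=
  [set f | smooth f /\ exists K : set E, [/\ compact K, K `<=` U & supp f `<=` K]].

Section Classes.
Variables (d : Order.disp_t) (L : porderType d) (M : L -> nat -> R).

(* Suffixes R and B: Roumieu and Beurling. *)
Definition E_R : set (E -> C) :=
  [set f | smooth f /\ forall K : set E, compact K ->
     exists x, exists2 h, 0 < h & (normM (M x) K h f < +oo)%E].

Definition E_B : set (E -> C) :=
  [set f | smooth f /\ forall K : set E, compact K ->
     forall x h, 0 < h -> (normM (M x) K h f < +oo)%E].

Definition D_R U : set (E -> C) :=
  [set f | test_functions U f /\
     exists x, exists2 h, 0 < h & (normM (M x) setT h f < +oo)%E].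

Definition D_B U : set (E -> C) :=
  [set f | test_functions U f /\
     forall x h, 0 < h -> (normM (M x) setT h f < +oo)%E].

Definition Domega_R U : set (E -> C) :=
  [set f | test_functions U f /\
     exists x, exists2 l, 0 < l & (normomega (omega (M x)) setT l f < +oo)%E].

Definition Domega_B U : set (E -> C) :=
  [set f | test_functions U f /\
     forall x l, 0 < l -> (normomega (omega (M x)) setT l f < +oo)%E].

Definition Dhat_R U : set (E -> C) :=
  [set f | test_functions U f /\
     exists x, exists2 h, 0 < h & (normhat (M x) h f < +oo)%E].

Definition Dhat_B U : set (E -> C) :=
  [set f | test_functions U f /\
     forall x h, 0 < h -> (normhat (M x) h f < +oo)%E].

End Classes.
End SmoothFunctions.

Arguments E_R {R} r {d L} M _.
Arguments E_B {R} r {d L} M _.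

(* Main.v *)
(* The equality of the first two classes is a comparison of weights.
   Log-convexity gives exp(phi^*_{omega_M}(k)) = M_k, and condition (ii) yields
   2 omega_{M^y}(t) <= omega_{M^x}(C t) for suitable x and y, so that a change
   of l can be traded for a change of x and h.

   For D into hat D, k integrations by parts in the direction of t bound
   |t|^k |f^(t)| by a multiple of the supremum of |f^(k)|; optimizing over k
   gives the factor exp(- omega_M(|t| / h)), half of which is kept to make the
   integral converge.  For hat D into D_omega, the supremum of |f^(k)| is at most
   a constant times the L^1 norm of its Fourier transform, and
   |t|^k <= exp(h phi^*(k / h)) exp(h omega_M(t)).  This L^1 bound is weaker
   than Fourier inversion: on the line it follows from pairing the transform
   with a Fejer kernel, and in higher dimension by induction, transforming one
   coordinate at a time. *)

Require Import Defs.
From HB Require Import structures.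
From mathcomp Require Import all_boot all_order all_algebra.
From mathcomp Require Import complex.
From mathcomp Require Import all_classical all_reals all_analysis.
From mathcomp Require Import measurable_realfun ring lra.

Set Implicit Arguments.
Unset Strict Implicit.
Unset Printing Implicit Defensive.

Import Order.TTheory GRing.Theory Num.Theory.
Import numFieldNormedType.Exports.

Local Open Scope classical_set_scope.
Local Open Scope ring_scope.

(** * Weights and their associated functions *)

(** Membership in a class only asks for some finite bound, so every estimate may lose a constant
    independent of the order [k]; this makes [(4 / cos 1) ^+ r] an acceptable price for avoiding an
    inversion formula. Losses that depend on [k] are the real issue. A multiple of the associated
    function costs, by condition (ii), a change of index and a dilation of the argument; under
    conjugation the dilation becomes a factor [C ^+ k], and such geometric factors are taken up by
    the parameter [h] or by condition (i).

    Complex functions are handled as pairs [(a, b)] of real ones. In the space variable all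
    integrands are bounded, measurable and zero outside a box, so that integrability and the
    exchange of integrals come at once. The induction over coordinates needs a class of functions
    preserved by transforming a single coordinate; uniformly continuous functions vanishing outside
    a fixed box form one. *)

Section Weights.
Variable R : realType.
Implicit Types M : nat -> R.

Lemma LC_gt0 M k : LC M -> 0 < M k.
Proof. by case. Qed.

Lemma LC_ratio_le M : LC M -> forall j k, (j <= k)%N ->
  M j.+1 / M j <= M k.+1 / M k.
Proof.
move=> hM j k; case: (hM) => M0 _ Mc _; elim: k => [|k IH].
  by rewrite leqn0 => /eqP ->.
rewrite leq_eqVlt => /predU1P[->//|]; rewrite ltnS => /IH/le_trans; apply.
rewrite ler_pdivrMr// mulrAC ler_pdivlMr//.
by have := Mc k.+1 isT; rewrite expr2 mulrC [X in _ <= X]mulrC.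
Qed.

Lemma LC_ratio_ge1 M k : LC M -> 1 <= M k.+1 / M k.
Proof.
move=> hM; have := LC_ratio_le hM (leq0n k); apply: le_trans.
by case: hM => _ [-> M1] _ _; rewrite divr1.
Qed.

Lemma LC_ge1 M k : LC M -> 1 <= M k.
Proof.
move=> hM; elim: k => [|k IH]; first by case: hM => _ [-> _].
have := LC_ratio_ge1 k hM; rewrite ler_pdivlMr ?LC_gt0// mul1r.
exact: le_trans.
Qed.

(** From some index on [M p] is at least [t ^+ p], so the logarithm is nonpositive; the finitely
    many earlier terms are bounded by the sum of their absolute values. *)
Lemma LC_ln_ubound M (t : R) : LC M -> 0 < t ->
  has_ubound (range (fun p : nat => ln (t ^+ p / M p))).
Proof.
move=> hM t0; case: (hM) => M0 _ _ /cvgryPge/(_ t)[N _ HN].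
exists (\sum_(i < N.+1) `|ln (t ^+ i / M i)|) => _ [p _ <-].
have [pN|Np] := leqP p N.
  rewrite (bigD1 (Ordinal (pN : (p < N.+1)%N)))//=.
  by rewrite (le_trans (ler_norm _))// lerDl sumr_ge0.
apply: (@le_trans _ _ 0); last by rewrite sumr_ge0.
apply: ln_le0; rewrite ler_pdivrMr// mul1r.
have := HN p (ltnW Np); rewrite /= => /(lerXn2r p).
rewrite !nnegrE powR_ge0 ltW// => /(_ isT isT)/le_trans; apply.
rewrite -powR_mulrn ?powR_ge0// -powRrM mulVf ?powRr1 ?(ltW (M0 _))//.
by rewrite pnatr_eq0 -lt0n (leq_ltn_trans _ Np).
Qed.

(** Replaces the supremum by a family of polynomial inequalities. It includes [t = 0], where [omega]
    is 0 by convention and the exponent [p = 0] on the right forces [0 <= B]. *)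
Lemma omega_leP M (t B : R) : LC M -> 0 <= t ->
  (omega M t <= B) <-> forall p, t ^+ p <= expR B * M p.
Proof.
move=> hM; have Mp p := LC_gt0 p hM.
rewrite le_eqVlt /omega => /predU1P[<-|t0]; rewrite ?eqxx ?gt_eqF//.
  split=> [B0 p|/(_ 0%N)]; last first.
    by case: hM => _ [-> _] _ _; rewrite expr0 mulr1 -{1}expR0 ler_expR.
  apply: (@le_trans _ _ 1); first by rewrite expr0n; case: (p == 0)%N.
  by apply: mulr_ege1; rewrite ?LC_ge1// -expR0 ler_expR.
have E p : (ln (t ^+ p / M p) <= B) = (t ^+ p <= expR B * M p).
  by rewrite -ler_expR lnK ?posrE ?divr_gt0 ?exprn_gt0// ler_pdivrMr.
split=> [H p|H].
  rewrite -E; apply: le_trans H; apply: ub_le_sup; last by exists p.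
  exact: LC_ln_ubound.
by apply: ge_sup; [exists (ln (t ^+ 0 / M 0%N)), 0%N|move=> _ [p _ <-]; rewrite E].
Qed.

Lemma exprn_le_omega M (t : R) p : LC M -> 0 <= t ->
  t ^+ p <= expR (omega M t) * M p.
Proof. by move=> hM t0; apply: (omega_leP _ hM t0).1. Qed.

Lemma omega_ge0 M (t : R) : LC M -> 0 <= t -> 0 <= omega M t.
Proof.
move=> hM t0; have := exprn_le_omega 0 hM t0.
by case: hM => _ [-> _] _ _; rewrite expr0 mulr1 -{1}expR0 ler_expR.
Qed.

Lemma le_omega M (s t : R) : LC M -> 0 <= s -> s <= t -> omega M s <= omega M t.
Proof.
move=> hM s0 st; apply/omega_leP => // p.
apply: le_trans (exprn_le_omega p hM (le_trans s0 st)).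
by apply: lerXn2r; rewrite ?nnegrE// (le_trans s0).
Qed.

Lemma omega_le1 M (t : R) : LC M -> 0 <= t <= 1 -> omega M t = 0.
Proof.
move=> hM /andP[t0 t1]; apply/eqP; rewrite eq_le omega_ge0// andbT.
apply/omega_leP => // p; rewrite expR0 mul1r.
by rewrite (le_trans _ (LC_ge1 p hM))// exprn_ile1.
Qed.

(* The supremum defining [omega M] is attained, for the exponent [k], at the
   ratio of consecutive weights; this is where log-convexity is used. *)
Lemma LC_critical M k : LC M ->
  exists2 t, 1 <= t & M k * expR (omega M t) <= t ^+ k.
Proof.
move=> hM; have Mp p := LC_gt0 p hM.
case: k => [|k].
  exists 1 => //; rewrite omega_le1 ?ler01 ?lexx// expR0 mulr1 expr0.
  by case: hM => _ [-> _].
set t := M k.+1 / M k; have t1 : 1 <= t := LC_ratio_ge1 k hM.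
have t0 : 0 < t by exact: lt_le_trans t1.
exists t => //.
rewrite mulrC -ler_pdivlMr// -[leRHS]lnK ?posrE ?divr_gt0 ?exprn_gt0//.
rewrite ler_expR; apply/omega_leP => //; first exact: ltW.
move=> p; rewrite lnK ?posrE ?divr_gt0 ?exprn_gt0//.
rewrite mulrAC ler_pdivlMr//.
(* The ratios of [M] are at least [t] from [k] on and at most [t] before, so [t ^+ p / M p]
   increases up to [p = k.+1] and decreases afterwards. *)
have [kp|pk] := leqP k.+1 p.
  rewrite -(subnKC kp); elim: (p - k.+1)%N => [|n IH]; first by rewrite addn0.
  rewrite addnS exprS -mulrA (le_trans (ler_wpM2l (ltW t0) IH))//.
  rewrite mulrCA ler_wpM2l ?exprn_ge0 ?(ltW t0)//.
  rewrite -ler_pdivlMr//; apply: LC_ratio_le => //.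
  by rewrite addSn leqW// leq_addr.
have {}pk : (p <= k.+1)%N by rewrite ltnW.
suff : M k.+1 <= t ^+ (k.+1 - p) * M p.
  move=> /(ler_wpM2l (exprn_ge0 p (ltW t0)))/le_trans; apply.
  by rewrite mulrA -exprD subnKC.
have : forall n, (n <= k.+1)%N -> M k.+1 <= t ^+ n * M (k.+1 - n)%N.
  elim=> [_|n IH nk]; first by rewrite subn0 expr0 mul1r.
  apply: (le_trans (IH (ltnW nk))).
  rewrite exprSr -mulrA ler_wpM2l ?exprn_ge0 ?(ltW t0)//.
  rewrite -ler_pdivrMr//; move: nk; rewrite ltnS => nk.
  by rewrite subSn// subSS; apply: LC_ratio_le => //; rewrite leq_subr.
by move=> /(_ _ (leq_subr p k.+1)); rewrite subKn.
Qed.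

(** For an integer [N >= x], the exponent [N] in the supremum [omega M (expR y)] already gives
    [x * y - omega M (expR y) <= ln (M N)]. *)
Lemma phi_star_ubound M (x : R) : LC M ->
  has_ubound [set x * y - phi (omega M) y | y in [set y : R | 0 <= y]].
Proof.
move=> hM; have [N xN] : exists N : nat, x <= N%:R.
  by exists (Num.truncn `|x|).+1; rewrite (le_trans (ler_norm _))// ltW// truncnS_gt.
exists (ln (M N)) => _ [y y0 <-]; rewrite lerBlDr.
apply: (@le_trans _ _ (N%:R * y)); first by rewrite ler_wpM2r.
have := exprn_le_omega N hM (expR_ge0 y).
rewrite -[M N in leRHS]lnK ?posrE ?LC_gt0// -expRD -expRM_natl ler_expR.
by rewrite addrC.
Qed.

Lemma phi_star_ge M (x t : R) : LC M -> 1 <= t ->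
  x * ln t - omega M t <= phi_star (omega M) x.
Proof.
move=> hM t1; apply: ub_le_sup; first exact: phi_star_ubound.
exists (ln t); first exact: ln_ge0.
by rewrite /phi lnK// posrE (lt_le_trans _ t1).
Qed.

Lemma phi_star_le M (x B : R) :
  (forall t, 1 <= t -> x * ln t - omega M t <= B) -> phi_star (omega M) x <= B.
Proof.
move=> H; apply: ge_sup.
  by exists (x * 0 - phi (omega M) 0), 0; rewrite //=.
move=> _ [y y0 <-]; have := H (expR y).
by rewrite expRK; apply; rewrite -expR0 ler_expR.
Qed.

Lemma phi_star_ge0 M (x : R) : LC M -> 0 <= phi_star (omega M) x.
Proof.
move=> hM; apply: le_trans (phi_star_ge x hM (lexx 1)).
by rewrite ln1 mulr0 omega_le1// ?ler01 ?lexx// subrr.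
Qed.

(** Young's inequality for [phi] and its conjugate at [ln t] and [k / h], multiplied by [h] and
    exponentiated. For [t < 1] the point [ln t] is outside the range of the supremum, but then the
    left side is at most 1 and both factors on the right are at least 1. *)
Lemma exprn_le_phi_star M (h t : R) k : LC M -> 0 < h -> 0 <= t ->
  t ^+ k <= expR (h * phi_star (omega M) (h^-1 * k%:R)) * expR (h * omega M t).
Proof.
move=> hM h0 t0; have [t1|t1] := leP 1 t; last first.
  apply: (@le_trans _ _ 1); first by rewrite exprn_ile1// ltW.
  by apply: mulr_ege1; rewrite -{1}expR0 ler_expR mulr_ge0 ?(ltW h0)//
    ?phi_star_ge0// omega_ge0.
have t0' : 0 < t by exact: lt_le_trans t1.
rewrite -expRD -mulrDr -[X in X ^+ k]lnK ?posrE//.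
rewrite -expRM_natl ler_expR -ler_pdivrMl//.
by rewrite mulrA -lerBlDr phi_star_ge.
Qed.

(** Conjugation reverses the hypothesis: [l * k * ln t - omega Mx t] is at most [l] times
    [k * ln t - omega My (t / C)], and the exponent [k] in the supremum [omega My (t / C)] bounds
    the latter by [ln (C ^+ k * My k)]. *)
Lemma expR_phi_star_le Mx My (l C : R) k : LC Mx -> LC My -> 0 < l -> 1 <= C ->
  (forall t, 0 <= t -> l * omega My t <= omega Mx (C * t)) ->
  expR (l^-1 * phi_star (omega Mx) (l * k%:R)) <= C ^+ k * My k.
Proof.
move=> hx hy l0 C1 H; have C0 : 0 < C by exact: lt_le_trans C1.
have CM0 : C ^+ k * My k \is Num.pos by rewrite posrE mulr_gt0 ?exprn_gt0 ?(LC_gt0 k hy).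
rewrite -(lnK CM0) ler_expR.
rewrite ler_pdivrMl//; apply: phi_star_le => t t1.
have t0 : 0 < t by exact: lt_le_trans t1.
have tC0 : 0 <= t / C by rewrite ltW// divr_gt0.
have := H _ tC0; rewrite mulrCA divff ?gt_eqF// mulr1 => Hx.
rewrite -mulrA -subr_ge0 opprB addrCA -mulrBr.
apply: (@le_trans _ _ (l * omega My (t / C) + l * (ln (C ^+ k * My k) - k%:R * ln t))).
  rewrite -mulrDr mulr_ge0 ?(ltW l0)// -ler_expR expR0.
  have := exprn_le_omega k hy tC0.
  rewrite expRD expRD (lnK CM0).
  rewrite expRN expRM_natl lnK ?posrE// => Hk.
  rewrite mulrA ler_pdivlMr ?exprn_gt0// mul1r mulrCA -ler_pdivrMl ?exprn_gt0//.
  by rewrite mulrC -expr_div_n.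
by rewrite lerD2r.
Qed.

(** The conjugate is tested at [t / C], where [t] is the critical point of [My] for the exponent
    [k]; there [My k] is at most [t ^+ k * expR (- omega My t)]. *)
Lemma expR_phi_star_ge Mx My (l C : R) k : LC Mx -> LC My -> 0 < l -> 1 <= C ->
  (forall t, 0 <= t -> omega Mx t <= l * omega My (C * t)) ->
  My k <= C ^+ k * expR (l^-1 * phi_star (omega Mx) (l * k%:R)).
Proof.
move=> hx hy l0 C1 H; have C0 : 0 < C by exact: lt_le_trans C1.
have [t t1 Ht] := LC_critical k hy; have t0 : 0 < t by exact: lt_le_trans t1.
(* If [t < C], then [t / C] lies below 1, outside the range of the conjugate; in that case
   [My k <= t ^+ k <= C ^+ k] suffices. *)
have [tC|Ct] := ltP t C.
  apply: (@le_trans _ _ (t ^+ k)).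
    apply: le_trans Ht; rewrite ler_peMr ?(ltW (LC_gt0 _ hy))//.
    by rewrite -{1}expR0 ler_expR omega_ge0// ltW.
  apply: (@le_trans _ _ (C ^+ k)).
    by apply: lerXn2r; rewrite ?nnegrE ltW.
  rewrite ler_peMr ?exprn_ge0 ?(ltW C0)// -{1}expR0 ler_expR mulr_ge0 ?invr_ge0 ?(ltW l0)//.
  exact: phi_star_ge0.
have s0 : 0 < t / C by rewrite divr_gt0.
have s1 : 1 <= t / C by rewrite ler_pdivlMr// mul1r.
have /= Hs := H _ (ltW s0); rewrite mulrCA divff ?gt_eqF// mulr1 in Hs.
apply: (@le_trans _ _ (C ^+ k * expR (k%:R * ln (t / C) - omega My t))).
  rewrite expRD expRM_natl lnK ?posrE// expRN expr_div_n mulrA.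
  by rewrite mulrCA divff ?mulr1 ?expf_neq0 ?gt_eqF// ler_pdivlMr ?expR_gt0.
rewrite ler_wpM2l ?exprn_ge0 ?(ltW C0)// ler_expR ler_pdivlMl//.
apply: le_trans (phi_star_ge _ hx s1).
by rewrite mulrBr mulrA lerD2l lerN2.
Qed.

(** With [j = k = p] the hypothesis reads [Mx (2 * p) <= (C ^+ p * My p) ^+ 2], so the term of
    exponent [2 * p] in [omega Mx (C * t)] is at least twice the term of exponent [p] in
    [omega My t]. *)
Lemma omega_double Mx My (C : R) : LC Mx -> LC My -> 1 <= C ->
  (forall j k, Mx (j + k)%N <= C ^+ (j + k) * My j * My k) ->
  forall t, 0 <= t -> 2 * omega My t <= omega Mx (C * t).
Proof.
move=> hx hy C1 H t t0; have C0 : 0 < C by exact: lt_le_trans C1.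
rewrite mulrC -ler_pdivlMr//; apply/omega_leP => // p.
have My0 := LC_gt0 p hy.
rewrite -(@ler_pXn2r _ 2%N)// ?nnegrE ?exprn_ge0// ?mulr_ge0 ?expR_ge0 ?(ltW My0)//.
have -> : (expR (omega Mx (C * t) / 2) * My p) ^+ 2 = expR (omega Mx (C * t)) * My p ^+ 2.
  by rewrite exprMn -expRM_natl; congr (expR _ * _); field.
rewrite -exprM mulnC.
have Ct0 : 0 <= C * t by rewrite mulr_ge0// ltW.
have := exprn_le_omega (p + p) hx Ct0.
rewrite addnn -mul2n exprMn -(@ler_pM2l _ (C ^+ (2 * p))) ?exprn_gt0//.
move=> /le_trans; apply; rewrite mulrCA ler_wpM2l ?expR_ge0//.
by have := H p p; rewrite addnn -mul2n -mulrA expr2.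
Qed.

End Weights.

(** * Multiples of associated functions within a weight matrix *)

Section WeightMatrix.
Variables (R : realType) (d : Order.disp_t) (L : porderType d) (M : L -> nat -> R).
Hypothesis hM : standard_weight_matrix M.

Let hLC x : LC (M x). Proof. by case: hM. Qed.


Lemma moderate_growth_ge1 (Mx My1 My2 : nat -> R) (C : R) : LC My1 -> LC My2 ->
  0 < C ->
  (forall j k, Mx (j + k)%N <= C ^+ (j + k) * My1 j * My2 k) ->
  forall j k, Mx (j + k)%N <= Num.max C 1 ^+ (j + k) * My1 j * My2 k.
Proof.
move=> h1 h2 C0 H j k; apply: le_trans (H j k) _.
have [p1 p2] := (LC_gt0 j h1, LC_gt0 k h2).
rewrite -!mulrA ler_wpM2r ?mulr_ge0 ?(ltW p1) ?(ltW p2)//.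
by apply: lerXn2r; rewrite ?nnegrE ?le_max ?(ltW C0) ?lexx.
Qed.

(** Doubling is iterated until [2 ^+ n >= a], and the dilation factors multiply. At each step the
    two indices given by moderate growth are replaced by a common upper bound. *)
Lemma omega_iter_R :
  (forall x : L, exists C : R, exists y1 y2 : L, 0 < C /\
      forall j k, M x (j + k)%N <= C ^+ (j + k) * M y1 j * M y2 k) ->
  forall (a : R) (x : L), exists2 C, 1 <= C & exists y, forall t, 0 <= t ->
    a * omega (M y) t <= omega (M x) (C * t).
Proof.
case: hM => up _ _ mono mg a x.
suff [n an] : exists n, a <= 2 ^+ n.
  have [C C1 [y H]] : exists2 C, 1 <= C & exists y, forall t, 0 <= t ->
      2 ^+ n * omega (M y) t <= omega (M x) (C * t).
    elim: n {a an} => [|n [C C1 [y IH]]].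
      by exists 1 => //; exists x => t t0; rewrite !mul1r.
    have [C' [y1 [y2 [C'0 H]]]] := mg y.
    have [z [y1z y2z]] := up y1 y2.
    exists (C * Num.max C' 1); first by rewrite mulr_ege1// le_max lexx orbT.
    exists z => t t0; rewrite exprSr -!mulrA; set D := Num.max C' 1.
    have D1 : 1 <= D by rewrite le_max lexx orbT.
    have Dt0 : 0 <= D * t by rewrite mulr_ge0// (le_trans _ D1).
    apply: le_trans (IH _ Dt0); rewrite ler_wpM2l ?exprn_ge0//.
    apply: omega_double => // j k.
    apply: le_trans (moderate_growth_ge1 _ _ C'0 H j k) _ => //.
    have D0 : 0 <= D by exact: le_trans D1.
    have Dn : 0 <= D ^+ (j + k) by rewrite exprn_ge0.
    have Mp w i : 0 <= M w i by rewrite ltW// LC_gt0.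
    by apply: ler_pM; rewrite ?mulr_ge0 ?Mp// ?ler_wpM2l ?mono.
  exists C => //; exists y => t t0; apply: le_trans (H t t0).
  by rewrite ler_wpM2r ?omega_ge0.
exists (Num.truncn `|a|).+1; rewrite (le_trans (ler_norm _))//.
apply: (le_trans (ltW (truncnS_gt _))).
by rewrite -natrX ler_nat ltnW// ltn_expl.
Qed.

(** The same iteration with the given index on the smaller side: moderate growth is applied with
    both indices equal to the current [y], and the new index takes the place of [y]. *)
Lemma omega_iter_B :
  (forall x1 x2 : L, exists C : R, exists y : L, 0 < C /\
      forall j k, M y (j + k)%N <= C ^+ (j + k) * M x1 j * M x2 k) ->
  forall (a : R) (x : L), exists2 C, 1 <= C & exists y, forall t, 0 <= t ->
    a * omega (M x) t <= omega (M y) (C * t).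
Proof.
move=> mg a x.
suff [n an] : exists n, a <= 2 ^+ n.
  have [C C1 [y H]] : exists2 C, 1 <= C & exists y, forall t, 0 <= t ->
      2 ^+ n * omega (M x) t <= omega (M y) (C * t).
    elim: n {a an} => [|n [C C1 [y IH]]].
      by exists 1 => //; exists x => t t0; rewrite !mul1r.
    have [C' [z [C'0 H]]] := mg y y.
    set D := Num.max C' 1.
    have D1 : 1 <= D by rewrite le_max lexx orbT.
    exists (D * C); first by rewrite mulr_ege1.
    exists z => t t0; rewrite exprS -!mulrA.
    have Ct0 : 0 <= C * t by rewrite mulr_ge0// (le_trans _ C1).
    apply: le_trans (omega_double (hLC z) (hLC y) D1 _ Ct0).
      by rewrite ler_wpM2l// IH.
    exact: moderate_growth_ge1.
  exists C => //; exists y => t t0; apply: le_trans (H t t0).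
  by rewrite ler_wpM2r ?omega_ge0.
exists (Num.truncn `|a|).+1; rewrite (le_trans (ler_norm _))//.
apply: (le_trans (ltW (truncnS_gt _))).
by rewrite -natrX ler_nat ltnW// ltn_expl.
Qed.

End WeightMatrix.

(** * Bounded functions on boxes and Fubini's theorem *)

Section BoundedFiniteSupport.
Context d (T : measurableType d) (R : realType).
Variables (mu : {measure set T -> \bar R}).

(** On a set of finite measure this single condition yields integrability and Fubini's theorem, and
    vanishing outside [D] lets all integrals run over the whole space. *)
Definition bounded_on (D : set T) (f : T -> R) :=
  [/\ measurable_fun [set: T] f, exists A : R, forall x, `|f x| <= A &
      forall x, ~ D x -> f x = 0].

Variable D : set T.
Hypotheses (mD : measurable D) (muD : (mu D < +oo)%E).

Lemma bounded_on_Rintegral (f : T -> R) : bounded_on D f ->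
  \int[mu]_x f x = \int[mu]_(x in D) f x.
Proof.
move=> [mf bf f0]; rewrite [RHS]Rintegral_mkcond; apply: eq_Rintegral => x _.
by rewrite patchE; case: ifPn => // /negP xD; rewrite f0// => Dx; apply: xD; rewrite inE.
Qed.

Lemma bounded_on_integrable (f : T -> R) : bounded_on D f ->
  mu.-integrable setT (EFin \o f).
Proof.
move=> [mf [A bf] f0]; rewrite (_ : f = f \_ D); last first.
  apply/funext => x; rewrite patchE; case: ifPn => // /negP xD; rewrite f0// => Dx.
  by apply: xD; rewrite inE.
rewrite -restrict_EFin; apply/integrable_restrict => //; rewrite setTI.
apply: measurable_bounded_integrable => //; first exact: measurable_funTS.
exists A; split; first exact: num_real.
by move=> B AB x _; apply: le_trans (bf x) (ltW AB).
Qed.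

Lemma le_Rintegral_bounded_on (f g : T -> R) : bounded_on D f -> bounded_on D g ->
  (forall x, f x <= g x) -> \int[mu]_x f x <= \int[mu]_x g x.
Proof. by move=> hf hg fg; apply: le_Rintegral => //; exact: bounded_on_integrable. Qed.

Lemma normr_Rintegral_bounded_on (f : T -> R) (A : R) : bounded_on D f ->
  (forall x, `|f x| <= A) -> `|\int[mu]_x f x| <= A * fine (mu D).
Proof.
move=> hf bf; rewrite (bounded_on_Rintegral hf).
have hfi : mu.-integrable D (EFin \o f).
  by apply: integrableS (bounded_on_integrable hf) => //; exact: measurableT.
rewrite (le_trans (le_normr_Rintegral mD hfi))// -Rintegral_cst//.
apply: le_Rintegral => //; first exact: integrable_norm.
rewrite (_ : _ \o _ = cst A%:E)//.
apply/integrableP; split; first exact: measurable_cst.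
by under eq_integral do rewrite abse_EFin; rewrite integral_cst//= lte_mul_pinfty ?lee_fin.
Qed.

End BoundedFiniteSupport.

Section BoundedFubini.
Context d1 d2 (T1 : measurableType d1) (T2 : measurableType d2) (R : realType).
Variables (m1 : {sigma_finite_measure set T1 -> \bar R})
          (m2 : {sigma_finite_measure set T2 -> \bar R}).
Variables (D1 : set T1) (D2 : set T2) (f : T1 * T2 -> R).
Hypotheses (mD1 : measurable D1) (m1D1 : (m1 D1 < +oo)%E).
Hypotheses (mD2 : measurable D2) (m2D2 : (m2 D2 < +oo)%E).
Hypothesis hf : bounded_on (D1 `*` D2) f.

Lemma bounded_on_section1 x : bounded_on D2 (fun y => f (x, y)).
Proof.
case: hf => mf [A bf] f0; split; first exact: measurableT_comp.
  by exists A.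
by move=> y D2y; apply: f0 => -[].
Qed.

Lemma bounded_on_section2 y : bounded_on D1 (fun x => f (x, y)).
Proof.
case: hf => mf [A bf] f0; split; first exact: measurableT_comp.
  by exists A.
by move=> x D1x; apply: f0 => -[].
Qed.

Lemma bounded_on_prod_integrable : (m1 \x m2)%E.-integrable setT (EFin \o f).
Proof.
have mD : measurable (D1 `*` D2) by exact: measurableX.
apply: (@bounded_on_integrable _ _ _ (m1 \x m2)%E _ mD _ _ hf).
rewrite [X in (X < _)%E](_ : _ = (m1 D1 * m2 D2)%E); last exact: product_measure1E.
by rewrite lte_mul_pinfty// ge0_fin_numE.
Qed.

Let hi := bounded_on_prod_integrable.

Lemma bounded_on_Rintegral1 : bounded_on D1 (fun x => \int[m2]_y f (x, y)).
Proof.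
split.
- apply: (measurableT_comp (fine_measurable measurableT)).
  exact: (@measurable_fubini_F _ _ _ _ _ m1 m2 (EFin \o f)).
- have [_ [A bf] _] := hf.
  exists (A * fine (m2 D2)) => x.
  by apply: normr_Rintegral_bounded_on => //; exact: bounded_on_section1.
- move=> x D1x; rewrite (_ : (fun y => _) = cst 0) ?Rintegral_cst ?mul0r//.
  by apply/funext => y /=; have [_ _ ->] := hf => // -[].
Qed.

Lemma bounded_on_Rintegral2 : bounded_on D2 (fun y => \int[m1]_x f (x, y)).
Proof.
split.
- apply: (measurableT_comp (fine_measurable measurableT)).
  exact: (@measurable_fubini_G _ _ _ _ _ m1 m2 (EFin \o f)).
- have [_ [A bf] _] := hf.
  exists (A * fine (m1 D1)) => y.
  by apply: normr_Rintegral_bounded_on => //; exact: bounded_on_section2.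
- move=> y D2y; rewrite (_ : (fun x => _) = cst 0) ?Rintegral_cst ?mul0r//.
  by apply/funext => x /=; have [_ _ ->] := hf => // -[].
Qed.

Lemma bounded_on_prod1E :
  \int[(m1 \x m2)%E]_z f z = \int[m1]_x \int[m2]_y f (x, y).
Proof.
congr fine; rewrite -(integral12_prod_meas1 hi); apply: eq_integral => x _.
rewrite /fubini_F/= fineK//; apply: integrable_fin_num => //.
by apply: bounded_on_integrable mD2 _ _ _ => //; exact: bounded_on_section1.
Qed.

Lemma bounded_on_prod2E :
  \int[(m1 \x m2)%E]_z f z = \int[m2]_y \int[m1]_x f (x, y).
Proof.
congr fine; rewrite -(integral21_prod_meas1 hi); apply: eq_integral => y _.
rewrite /fubini_G/= fineK//; apply: integrable_fin_num => //.
by apply: bounded_on_integrable mD1 _ _ _ => //; exact: bounded_on_section2.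
Qed.

End BoundedFubini.

(** * Boxes and iterated integrals for Lebesgue measure on tuples *)

Section LebesgueTuple.
Variable R : realType.
Local Notation T := (measurableTypeR R).
Local Notation leb := (lebesgue_tuple R).
Local Notation mu := (@lebesgue_measure R).

Definition seg (B : R) : set T := `[- B, B].

Definition box n (B : R) : set (n.-tuple T) :=
  [set s | forall i, `|tnth s i : R| <= B].

Lemma segP (B y : R) : seg B y <-> `|y| <= B.
Proof. by rewrite /seg/= in_itv/= ler_norml. Qed.

Lemma measurable_seg (B : R) : measurable (seg B).
Proof. exact: measurable_itv. Qed.

Lemma lebesgue_seg (B : R) : 0 <= B -> mu (seg B) = (B *+ 2)%:E.
Proof.
move=> B0; rewrite /seg lebesgue_measure_itv/= lte_fin.
case: ltP => [_|]; first by rewrite -EFinD opprK mulr2n.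
move=> H; rewrite (_ : B = 0) ?mul0rn//; lra.
Qed.

Lemma lebesgue_seg_lty (B : R) : (mu (seg B) < +oo)%E.
Proof. by rewrite /seg lebesgue_measure_itv/=; case: ifP => _; rewrite ?ltry. Qed.

Lemma measurable_box n (B : R) : measurable (@box n B).
Proof.
rewrite (_ : box B = \bigcap_(i in [set: 'I_n]) ((fun s : n.-tuple T =>
  tnth s i) @^-1` seg B)).
  apply: fin_bigcap_measurable => // i _; rewrite -[X in measurable X]setTI.
  exact: (measurable_tnth i _ (measurable_seg B)).
by apply/seteqP; split => [s H i _|s H i]; [apply/segP|apply/segP; exact: H].
Qed.

Lemma tuple_cons_box n (B : R) :
  @tuple_cons R n @^-1` (box B) = (box B) `*` (seg B).
Proof.
apply/seteqP; split => [[s y]/= H|[s y]/= [Hs Hy] i].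
  split; last by apply/segP; exact: H ord0.
  by move=> i; have := H (lift ord0 i); rewrite tnthS.
case: (unliftP ord0 i) => [j ->|->]; last by apply/segP.
by rewrite tnthS.
Qed.

Lemma lebesgue_tuple_box n (B : R) : (leb n (box B) < +oo)%E.
Proof.
elim: n => [|n IH]; first by rewrite /= diracE; case: (_ \in _); rewrite ltry.
rewrite /= /pushforward tuple_cons_box product_measure1E//.
- by rewrite lte_mul_pinfty ?ge0_fin_numE// lebesgue_seg_lty.
- exact: measurable_box.
- exact: measurable_seg.
Qed.

Lemma lebesgue_tuple_sigma_finite n : sigma_finite setT (leb n).
Proof.
exists (fun k => box k%:R); last first.
  by move=> k; split; [exact: measurable_box|exact: lebesgue_tuple_box].
apply/seteqP; split => // s _; exists (Num.truncn (\sum_i `|tnth s i : R|)).+1 => // i.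
apply: le_trans (ltW (truncnS_gt _)).
by rewrite (bigD1 i)//= lerDl sumr_ge0.
Qed.

(* A copy of [lebesgue_tuple] that carries the sigma-finite structure required
   by Fubini's theorem. *)
Definition lebs n : set (n.-tuple T) -> \bar R := leb n.

HB.instance Definition _ n := isMeasure.Build _ _ _ (@lebs n)
  (measure0 (leb n)) (measure_ge0 (leb n)) (@measure_semi_sigma_additive _ _ _ (leb n)).

HB.instance Definition _ n := Measure_isSigmaFinite.Build _ _ _ (@lebs n)
  (lebesgue_tuple_sigma_finite n).

Lemma integral_lebesgue_tupleS n (f : n.+1.-tuple T -> \bar R) :
  measurable_fun setT f -> (forall s, 0 <= f s)%E ->
  (\int[leb n.+1]_s f s = \int[mu]_y \int[leb n]_s f (tuple_cons (s, y)))%E.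
Proof.
move=> mf f0.
rewrite [LHS](@ge0_integral_pushforward _ _ _ _ _ _ (@measurable_tuple_cons R n)
   (product_measure1 (leb n) mu))//.
rewrite preimage_setT.
have mc : measurable_fun setT (f \o @tuple_cons R n).
  exact: measurableT_comp mf (@measurable_tuple_cons R n).
exact: (@fubini_tonelli2 _ _ _ _ _ (@lebs n) mu (f \o @tuple_cons R n) mc (fun z => f0 _)).
Qed.

Lemma bounded_on_tuple_cons n (B : R) (f : n.+1.-tuple T -> R) :
  bounded_on (box B) f -> bounded_on (box B `*` seg B) (f \o @tuple_cons R n).
Proof.
move=> [mf [A bf] f0]; split.
- exact: measurableT_comp mf (@measurable_tuple_cons R n).
- by exists A => x; exact: bf.
- by move=> x Hx; apply: f0; rewrite -tuple_cons_box in Hx.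
Qed.

Section FubiniBox.
Variables (n : nat) (B : R) (f : n.+1.-tuple T -> R).
Hypothesis hf : bounded_on (box B) f.

Let hfc := bounded_on_tuple_cons hf.
Let mb := @measurable_box n B.
Let ms := measurable_seg B.
Let lb := @lebesgue_tuple_box n B.
Let ls := lebesgue_seg_lty B.

Lemma bounded_on_slice y : bounded_on (box B) (fun s => f (tuple_cons (s, y))).
Proof. exact: (@bounded_on_section2 _ _ _ _ _ (box B) (seg B) _ hfc). Qed.

Lemma bounded_on_fiber s : bounded_on (seg B) (fun y => f (tuple_cons (s, y))).
Proof. exact: (@bounded_on_section1 _ _ _ _ _ (box B) (seg B) _ hfc). Qed.

Lemma bounded_on_fiber_Rintegral :
  bounded_on (box B) (fun s => \int[mu]_y f (tuple_cons (s, y))).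
Proof. exact: (@bounded_on_Rintegral1 _ _ _ _ _ (@lebs n) mu _ _ _ mb lb ms ls hfc). Qed.

Let pushE : \int[leb n.+1]_s f s =
  \int[product_measure1 (leb n) mu]_z f (tuple_cons z).
Proof.
rewrite /Rintegral; congr fine.
have mf : measurable_fun setT (EFin \o f) by apply/measurable_EFinP; case: hf.
rewrite [LHS](@integral_pushforward _ _ _ _ _ _ (@measurable_tuple_cons R n)
   (product_measure1 (leb n) mu) setT (EFin \o f) mf)//.
exact: (@bounded_on_prod_integrable _ _ _ _ _ (@lebs n) mu _ _ _ mb lb ms ls hfc).
Qed.

Lemma Rintegral_lebesgue_tupleS_slice :
  \int[leb n.+1]_s f s = \int[mu]_y \int[leb n]_s f (tuple_cons (s, y)).
Proof. rewrite pushE; exact: (@bounded_on_prod2E _ _ _ _ _ (@lebs n) mu _ _ _ mb lb ms ls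
  hfc). Qed.

Lemma Rintegral_lebesgue_tupleS_fiber :
  \int[leb n.+1]_s f s = \int[leb n]_s \int[mu]_y f (tuple_cons (s, y)).
Proof. rewrite pushE; exact: (@bounded_on_prod1E _ _ _ _ _ (@lebs n) mu _ _ _ mb lb ms ls
  hfc). Qed.

End FubiniBox.

End LebesgueTuple.

(** * The Fejer kernel *)

Section Fejer.
Variable R : realType.
Local Notation mu := (@lebesgue_measure R).
Implicit Types (a b : R -> R) (N u t s x B : R).

(** Folding onto [[0, N]] removes the absolute value from the kernel and makes odd integrands
    cancel. *)
Lemma Rintegral_seg_symm (f : R -> R) N : 0 < N -> continuous f ->
  \int[mu]_(t in `[- N, N]) f t = \int[mu]_(t in `[0, N]) (f t + f (- t)).
Proof.
move=> N0 cf.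
have ci (g : R -> R) p q : continuous g -> mu.-integrable `[p, q] (EFin \o g).
  move=> cg; apply: continuous_compact_integrable; first exact: segment_compact.
  exact: continuous_subspaceT.
have cfN : continuous (f \o -%R).
  by move=> t; apply: continuous_comp; [exact: opp_continuous|exact: cf].
rewrite RintegralD//; [|exact: ci|exact: ci].
have N0' : - N <= 0 by rewrite oppr_le0 ltW.
have := @Rintegral_itvB _ f (BLeft (- N)) (BRight N) 0 (ci f _ _ cf).
rewrite !bnd_simp => /(_ N0' (ltW N0))/eqP; rewrite subr_eq => /eqP ->.
rewrite Rintegral_itv_obnd_cbnd; last first.
  apply: integrableS (ci f 0 N cf) => //; first exact: subset_itv_oc_cc.
congr (_ + _); rewrite /Rintegral -{1}oppr0 (@integration_by_substitution_oppr R f 0 N)//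
  ?ltW//.
exact: continuous_subspaceT.
Qed.

(** The triangle function on [[- N, N]]. The Fejer kernel proper is its cosine transform
    [fejer_cos N]. *)
Definition fejer N t : R := Num.max 0 (1 - `|t| / N).

Lemma fejer_ge0 N t : 0 <= fejer N t.
Proof. by rewrite le_max lexx. Qed.

Lemma fejer_le1 N t : 0 < N -> fejer N t <= 1.
Proof. by move=> N0; rewrite ge_max ler01/= gerBl divr_ge0// ltW. Qed.

Lemma continuous_fejer N : continuous (fejer N).
Proof.
move=> t; apply: (@continuous_max _ _ (cst 0) (fun t => 1 - `|t| / N) t).
  exact: cst_continuous.
apply: cvgB; first exact: cvg_cst.
apply: cvgM; last exact: cvg_cst.
exact: norm_continuous.
Qed.

Lemma fejer_out N t : 0 < N -> ~ seg N t -> fejer N t = 0.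
Proof.
move=> N0 /segP/negP; rewrite -ltNge => Nt; apply/max_idPl.
by rewrite subr_le0 ler_pdivlMr// mul1r ltW.
Qed.

Lemma continuous_cosM u : continuous (fun t => cos (u * t)).
Proof.
move=> t; apply: (continuous_comp (f := *%R u)); last exact: continuous_cos.
exact: mulrl_continuous.
Qed.

Lemma continuous_sinM u : continuous (fun t => sin (u * t)).
Proof.
move=> t; apply: (continuous_comp (f := *%R u)); last exact: continuous_sin.
exact: mulrl_continuous.
Qed.

Definition fejer_cos N u := \int[mu]_t (fejer N t * cos (u * t)).
Definition fejer_sin N u := \int[mu]_t (fejer N t * sin (u * t)).

Lemma bounded_on_fejerM N (g : R -> R) : 0 < N -> continuous g ->
  (forall t, `|g t| <= 1) -> bounded_on (seg N) (fun t => fejer N t * g t).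
Proof.
move=> N0 cg g1; split.
- by apply: continuous_measurable_fun => t; apply: cvgM; [exact: continuous_fejer|exact: cg].
- by exists 1 => t; rewrite normrM mulr_ile1// ger0_norm ?fejer_ge0 ?fejer_le1.
- by move=> t Nt; rewrite fejer_out// mul0r.
Qed.

Lemma fejer_sin0 N u : 0 < N -> fejer_sin N u = 0.
Proof.
move=> N0; rewrite /fejer_sin.
rewrite (bounded_on_Rintegral (D := seg N) mu); last first.
  by apply: bounded_on_fejerM => //; [exact: continuous_sinM|move=> t; exact: sin_max].
rewrite /seg Rintegral_seg_symm//; last first.
  by move=> t; apply: cvgM; [exact: continuous_fejer|exact: continuous_sinM].
rewrite (_ : (fun t => _) = cst 0) ?Rintegral_cst ?mul0r//.
by apply/funext => t; rewrite /fejer normrN mulrN sinN mulrN subrr.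
Qed.

Lemma fejer_cosE N u : 0 < N -> u != 0 ->
  fejer_cos N u = 2 * (1 - cos (u * N)) / (N * u ^+ 2).
Proof.
move=> N0 u0; rewrite /fejer_cos.
rewrite (bounded_on_Rintegral (D := seg N) mu); last first.
  by apply: bounded_on_fejerM => //; [exact: continuous_cosM|move=> t; exact: cos_max].
rewrite /seg Rintegral_seg_symm//; last first.
  by move=> t; apply: cvgM; [exact: continuous_fejer|exact: continuous_cosM].
pose f t := 2 * ((1 - t / N) * cos (u * t)).
(* An antiderivative of [f], found by integrating [(1 - t / N) * cos (u * t)] by parts. *)
pose F t := 2 * ((1 - t / N) * sin (u * t) / u - cos (u * t) / (N * u ^+ 2)).
have Nn0 : N != 0 by rewrite gt_eqF.
rewrite (@eq_Rintegral _ _ _ mu _ f); last first.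
  move=> t; rewrite inE/= in_itv/= => /andP[t0 tN].
  have -> : fejer N (- t) = fejer N t by rewrite /fejer normrN.
  rewrite mulrN cosN -mulr2n -mulr_natl /f; congr (_ * (_ * _)).
  rewrite /fejer ger0_norm//; apply/max_idPr.
  by rewrite subr_ge0 ler_pdivrMr// mul1r.
have dF t : is_derive t 1 F (f t).
  rewrite /F /f; apply: is_derive_eq; rewrite /GRing.scale/=.
  by field; rewrite u0 Nn0.
have cF : continuous F.
  move=> t; apply: differentiable_continuous; apply/derivable1_diffP.
  by have [] := dF t.
rewrite /Rintegral (@continuous_FTC2 _ f F)//.
- rewrite /= /F mulr0 cos0 sin0 divff// subrr; field; rewrite u0 Nn0//.
- apply: continuous_subspaceT => t; rewrite /f.
  apply: cvgM; first exact: cvg_cst.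
  apply: cvgM; last exact: continuous_cosM.
  apply: cvgB; first exact: cvg_cst.
  by apply: cvgM; [exact: cvg_id|exact: cvg_cst].
- split.
  + by move=> t _; have [] := dF t.
  + by apply: cvg_at_right_filter; exact: cF.
  + by apply: cvg_at_left_filter; exact: cF.
- by move=> t _; rewrite derive1E; have [_ ->] := dF t.
Qed.

Lemma fejer_cos_le N u : 0 < N -> u != 0 -> fejer_cos N u <= 4 / (N * u ^+ 2).
Proof.
move=> N0 u0; rewrite fejer_cosE// ler_wpM2r//.
  by rewrite invr_ge0 mulr_ge0 ?sqr_ge0// ltW.
by have := cos_geN1 (u * N); lra.
Qed.

Lemma fejer_cos_ge0 N u : 0 < N -> u != 0 -> 0 <= fejer_cos N u.
Proof.
move=> N0 u0; rewrite fejer_cosE//; apply: divr_ge0.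
  by have := cos_le1 (u * N); lra.
by rewrite mulr_ge0 ?sqr_ge0// ltW.
Qed.

Lemma cos_ge_cos1 t : `|t| <= 1 -> cos 1 <= cos t.
Proof.
move=> t1; rewrite -(cos_norm t) leNgt; apply/negP.
have p1 : (1 : R) <= pi by rewrite (le_trans _ (pi_ge2 R))// ler1n.
rewrite ltr_cos ?in_itv/= ?normr_ge0 ?ler01 ?p1 ?(le_trans t1)// ltNge.
by rewrite t1.
Qed.

(** On the support [|u * t| <= 1], hence [cos (u * t) >= cos 1], and the triangle is at least
    [1 / 2] on an interval of length [N]. The bound includes [u = 0], where the closed formula has
    no meaning. *)
Lemma fejer_cos_ge N u : 0 < N -> `|u| <= N^-1 -> cos 1 / 2 * N <= fejer_cos N u.
Proof.
move=> N0 uN; have c0 := @cos1_gt0 R.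
pose g (t : R) : R := (cos 1 / 2) * \1_(seg (N / 2)) t.
have Nh : 0 <= N / 2 by lra.
have bg : bounded_on (seg N) g.
  split.
  - by apply: measurable_funM => //; apply: measurable_indic; exact: measurable_seg.
  - exists (cos 1 / 2) => t; rewrite normrM ger0_norm; last by lra.
    by rewrite indicE; case: (t \in _); rewrite /= ?normr1 ?normr0; lra.
  - move=> t /segP Nt; rewrite /g indicE memNset ?mulr0// => /segP h.
    by apply: Nt; rewrite (le_trans h)//; lra.
apply: (@le_trans _ _ (\int[mu]_t g t)).
  have E : \int[mu]_t (\1_(seg (N / 2)) t : R) = N.
    rewrite /Rintegral integral_indic//; last exact: measurable_seg.
    rewrite setIT; transitivity (fine ((N / 2) *+ 2)%:E).
      by congr fine; exact: lebesgue_seg.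
    by rewrite /= -mulr_natr; field.
  rewrite /g RintegralZl ?E//.
  exact: (integrable_indic_itv (- (N / 2)) (N / 2) true false).
apply: le_Rintegral_bounded_on bg _ _ => //; first exact: measurable_seg.
- exact: lebesgue_seg_lty.
- by apply: bounded_on_fejerM => //; [exact: continuous_cosM|move=> t; exact: cos_max].
move=> t; rewrite /g indicE; have [Nt|Nt] := pselect (`|t| <= N).
  have h1 : cos 1 <= cos (u * t).
    apply: cos_ge_cos1; rewrite normrM -(mulVf (lt0r_neq0 N0)).
    by rewrite ler_pM.
  have h2 : 0 <= fejer N t by exact: fejer_ge0.
  case: (boolP (t \in _)) => [|_]; last by rewrite mulr0 mulr_ge0//; lra.
  rewrite inE => /segP th; rewrite mulr1 mulrC.
  have : 2^-1 <= fejer N t.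
    rewrite /fejer le_max; apply/orP; right.
    have : `|t| / N <= 2^-1 by rewrite ler_pdivrMr// mulrC.
    lra.
  by move=> h3; apply: ler_pM => //; lra.
rewrite memNset ?mulr0 ?fejer_out ?mul0r//.
  by move=> /segP.
by move=> /segP h; apply: Nt; lra.
Qed.

End Fejer.

(** * Bounding a function by its Fourier transform *)

(** Tonelli's theorem on the positive and negative parts. It is meant for transforms as functions of
    the frequency, which ranges over an unbounded set and so escapes the bounded form of Fubini's
    theorem. *)
Lemma measurable_Rintegral d1 d2 (T1 : measurableType d1) (T2 : measurableType d2)
    (R : realType) (m2 : {sigma_finite_measure set T2 -> \bar R})
    (f : T1 * T2 -> R) : measurable_fun setT f ->
  measurable_fun setT (fun x => \int[m2]_y f (x, y)).
Proof.
move=> mf; apply: (measurableT_comp (fine_measurable measurableT)).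
have mef : measurable_fun setT (EFin \o f) by exact/measurable_EFinP.
rewrite (_ : (fun x => _) = ((fun x => \int[m2]_y (EFin \o f)^\+ (x, y)) \-
    (fun x => \int[m2]_y (EFin \o f)^\- (x, y)))%E); last first.
  apply/funext => x; rewrite [LHS]integralE.
  by congr (_ - _)%E; apply: eq_integral => y _; [rewrite !funeposE|rewrite !funenegE].
apply: emeasurable_funB.
- by apply: measurable_fun_fubini_tonelli_F => //; exact: measurable_funepos.
- by apply: measurable_fun_fubini_tonelli_F => //; exact: measurable_funeneg.
Qed.

Section FourierLine.
Variable R : realType.
Local Notation mu := (@lebesgue_measure R).
Implicit Types (a b : R -> R) (N u t s x B : R).

(** The real part of the Fourier transform of [a + i b] on the line; [trig1 b (- a)] is the
    imaginary part. *)
Definition trig1 a b t : R := \int[mu]_s (a s * cos (s * t) + b s * sin (s * t)).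

Lemma measurable_trig d (T : measurableType d) (a b h : T -> R) :
  measurable_fun setT a -> measurable_fun setT b -> measurable_fun setT h ->
  measurable_fun setT (fun p => a p * cos (h p) + b p * sin (h p)).
Proof.
move=> ma mb mh; apply: measurable_funD; apply: measurable_funM => //.
- exact: measurableT_comp (continuous_measurable_fun (@continuous_cos R)) mh.
- exact: measurableT_comp (continuous_measurable_fun (@continuous_sin R)) mh.
Qed.

Lemma bounded_on_trig d (T : measurableType d) (D : set T) (a b h : T -> R) :
  bounded_on D a -> bounded_on D b -> measurable_fun setT h ->
  bounded_on D (fun p => a p * cos (h p) + b p * sin (h p)).
Proof.
move=> [ma [A ha] a0] [mb [B hb] b0] mh; split; first exact: measurable_trig.
- exists (A + B) => p; rewrite (le_trans (ler_normD _ _))// !normrM lerD//.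
  + by rewrite (le_trans _ (ha p))// ler_piMr// cos_max.
  + by rewrite (le_trans _ (hb p))// ler_piMr// sin_max.
- by move=> p Ds; rewrite a0// b0// !mul0r addr0.
Qed.

Lemma bounded_onN d (T : measurableType d) (D : set T) (a : T -> R) :
  bounded_on D a -> bounded_on D (fun p => - a p).
Proof.
move=> [ma [A ha] a0]; split; first exact: measurable_funN.
- by exists A => p; rewrite normrN.
- by move=> p Ds; rewrite a0// oppr0.
Qed.

Lemma measurable_trig1 a b : measurable_fun setT a -> measurable_fun setT b ->
  measurable_fun setT (trig1 a b).
Proof.
move=> ma mb.
apply: (@measurable_Rintegral _ _ _ _ _ mu
  (fun p => a p.2 * cos (p.2 * p.1) + b p.2 * sin (p.2 * p.1))).
apply: measurable_trig.
- exact: measurableT_comp.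
- exact: measurableT_comp.
- exact: measurable_funM.
Qed.

Section Bound.
Variables (a b : R -> R) (x B : R).
Hypotheses (ha : bounded_on (seg B) a) (hb : bounded_on (seg B) b).

Let J := (\int[mu]_t (`|trig1 a b t| + `|trig1 b (fun s => - a s) t|)%:E)%E.

(** The real part of [fejer N t * (a + i b)(s) * e^(i (x - s) t)]. Integrated in [s] first, it is
    the modulated transform, controlled by [J]; integrated in [t] first, its sine part drops out by
    oddness and [a s * fejer_cos N (s - x)] remains. *)
Let f N (p : R * R) := fejer N p.1 *
  (a p.2 * cos ((p.2 - x) * p.1) + b p.2 * sin ((p.2 - x) * p.1)).

Let bf N : 0 < N -> bounded_on (seg N `*` seg B) (f N).
Proof.
move=> N0; case: ha hb => [ma [A bA] a0] [mb [A' bA'] b0]; split.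
- apply: measurable_funM.
    by apply: measurableT_comp => //; apply: continuous_measurable_fun;
      exact: continuous_fejer.
  apply: measurable_trig.
  + exact: measurableT_comp.
  + exact: measurableT_comp.
  + by apply: measurable_funM => //; apply: measurable_funB.
- exists (A + A') => -[t s]; rewrite /f/= normrM -[leRHS]mul1r ler_pM//.
    by rewrite ger0_norm ?fejer_ge0// fejer_le1.
  rewrite (le_trans (ler_normD _ _))// !normrM lerD//.
  + by rewrite (le_trans _ (bA s))// ler_piMr// cos_max.
  + by rewrite (le_trans _ (bA' s))// ler_piMr// sin_max.
- move=> -[t s] /= Hts; rewrite /f/=; have [Nt|Nt] := pselect (seg N t).
    have Bs : ~ seg B s by move=> Bs; exact: Hts.
    by rewrite a0// b0// !mul0r addr0 mulr0.
  by rewrite fejer_out// mul0r.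
Qed.

Let inner N s : 0 < N -> \int[mu]_t f N (t, s) = a s * fejer_cos N (s - x).
Proof.
move=> N0; rewrite /f/=.
have ic u : mu.-integrable setT (EFin \o (fun t => fejer N t * cos (u * t))).
  apply: bounded_on_integrable (measurable_seg N) (lebesgue_seg_lty N) _ _.
  by apply: bounded_on_fejerM => //; [exact: continuous_cosM|move=> t; exact: cos_max].
have isn u : mu.-integrable setT (EFin \o (fun t => fejer N t * sin (u * t))).
  apply: bounded_on_integrable (measurable_seg N) (lebesgue_seg_lty N) _ _.
  by apply: bounded_on_fejerM => //; [exact: continuous_sinM|move=> t; exact: sin_max].
under eq_Rintegral do rewrite mulrDr mulrCA [X in _ + X]mulrCA.
rewrite RintegralD//; first 1 last.
- exact: integrableZl (ic _).
- exact: integrableZl (isn _).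
rewrite RintegralZl ?RintegralZl//.
rewrite -[X in _ + _ * X]/(fejer_sin N (s - x)) fejer_sin0// mulr0 addr0//.
Qed.

Let bounded_inner N : 0 < N -> bounded_on (seg B) (fun s => a s * fejer_cos N (s - x)).
Proof.
move=> N0; have := bounded_on_Rintegral2 (m1 := mu) (m2 := mu) (measurable_seg N)
  (lebesgue_seg_lty N) (measurable_seg B) (lebesgue_seg_lty B) (bf N0).
by congr bounded_on; apply/funext => s; rewrite inner.
Qed.

Let fubini_f N : 0 < N ->
  \int[mu]_t \int[mu]_s f N (t, s) = \int[mu]_s (a s * fejer_cos N (s - x)).
Proof.
move=> N0.
rewrite -(bounded_on_prod1E (m1 := mu) (m2 := mu) (measurable_seg N) (lebesgue_seg_lty N)
  (measurable_seg B) (lebesgue_seg_lty B) (bf N0)).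
rewrite (bounded_on_prod2E (m1 := mu) (m2 := mu) (measurable_seg N) (lebesgue_seg_lty N)
  (measurable_seg B) (lebesgue_seg_lty B) (bf N0)).
by apply: eq_Rintegral => s _; rewrite inner.
Qed.

Let upper N : 0 < N -> ((\int[mu]_t \int[mu]_s f N (t, s))%:E <= J)%E.
Proof.
move=> N0.
have bF := bounded_on_Rintegral1 (m1 := mu) (m2 := mu) (measurable_seg N) (lebesgue_seg_lty N)
  (measurable_seg B) (lebesgue_seg_lty B) (bf N0).
have iF := bounded_on_integrable (measurable_seg N) (lebesgue_seg_lty N) bF.
rewrite /Rintegral fineK ?integrable_fin_num//.
have mF := measurable_int _ iF.
apply: (le_trans (lee_abs _)); apply: (le_trans (le_abse_integral mu measurableT mF)).
have [[ma _ _] [mb _ _]] := (ha, hb).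
apply: ge0_le_integral => //.
- exact: measurableT_comp.
- apply/measurable_EFinP; apply: measurable_funD; apply: measurableT_comp => //.
  + exact: measurable_trig1.
  + by apply: measurable_trig1 => //; exact: measurable_funN.
move=> t _; rewrite lee_fin.
rewrite (_ : (fun s => f N (t, s)) = (fun s => fejer N t *
    (cos (x * t) * (a s * cos (s * t) + b s * sin (s * t)) -
     sin (x * t) * (b s * cos (s * t) + (- a s) * sin (s * t))))); last first.
  apply/funext => s; rewrite /f/= mulrBl cosB sinB; ring.
have i1 : mu.-integrable setT (EFin \o (fun s => a s * cos (s * t) + b s * sin (s * t))).
  apply: bounded_on_integrable (measurable_seg B) (lebesgue_seg_lty B) _ _.
  by apply: bounded_on_trig => //; exact: measurable_funM.
have i2 : mu.-integrable setT (EFin \o (fun s => b s * cos (s * t) + (- a s) * sin (s * t))).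
  apply: bounded_on_integrable (measurable_seg B) (lebesgue_seg_lty B) _ _.
  by apply: bounded_on_trig => //; [exact: bounded_onN|exact: measurable_funM].
have i1' : mu.-integrable setT (EFin \o (fun s =>
  cos (x * t) * (a s * cos (s * t) + b s * sin (s * t)))).
  exact: integrableZl i1.
have i2' : mu.-integrable setT (EFin \o (fun s =>
  sin (x * t) * (b s * cos (s * t) + (- a s) * sin (s * t)))).
  exact: integrableZl i2.
rewrite RintegralZl//; last exact: integrableB i1' i2'.
rewrite RintegralB// RintegralZl// RintegralZl// -!/(trig1 _ _ _).
rewrite normrM ger0_norm ?fejer_ge0//.
apply: (@le_trans _ _ (1 * (`|trig1 a b t| + `|trig1 b (fun s => - a s) t|)));
  last by rewrite mul1r.
apply: ler_pM => //; rewrite ?fejer_ge0 ?fejer_le1//.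
rewrite (le_trans (ler_normB _ _))// !normrM lerD// ler_piMl// ?cos_max ?sin_max//.
Qed.

Hypothesis ca : forall e : R, 0 < e -> exists2 dl : R, 0 < dl &
  forall y : R, `|y - x| < dl -> `|a y - a x| <= e.

(* Pairing the transform with the Fejer kernel of width [1 / N] at [x] recovers a
   multiple of [a x]: the kernel is nonnegative, at least [cos 1 / 2 * N] at
   distance [1 / N] from [x], and [O(1 / N)] at distance [dl]. *)
Lemma trig1_bound_pos : 0 < a x -> ((a x)%:E <= (2 / cos 1)%:E * J)%E.
Proof.
move=> ax0; have c0 := @cos1_gt0 R; set c := cos 1 in c0 *.
have J0 : (0 <= J)%E by apply: integral_ge0 => t _; rewrite lee_fin addr_ge0.
have [Jy|] := eqVneq J +oo%E; first by rewrite Jy gt0_muley ?leey// lte_fin divr_gt0.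
move=> Jny; have Jfin : J \is a fin_num by rewrite ge0_fin_numE// lt_neqAle Jny leey.
rewrite -(fineK Jfin) -EFinM lee_fin.
have ax20 : 0 < a x / 2 by rewrite divr_gt0.
have [dl dl0 Hdl] := ca ax20.
have [ma [A0 bA0] a0] := ha; pose A := `|A0|.
have bA y : `|a y| <= A by rewrite (le_trans (bA0 y))// ler_norm.
pose V := fine (mu (seg B)).
have V0 : 0 <= V by rewrite fine_ge0.
(* The main term is the lower bound [a x / 2 * (c / 2 * N)] times the length [2 / N] of the interval
   around [x]. The error is [4 * A / (N * dl ^+ 2)], valid at distance at least [dl], times the
   length [V] of the segment outside which [a] vanishes. *)
have key N : 0 < N -> N^-1 < dl -> c / 2 * a x - (4 * A * V / dl ^+ 2) * N^-1 <= fine J.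
  move=> N0 Ndl; rewrite -lee_fin fineK//; apply: le_trans (upper N0).
  rewrite lee_fin fubini_f//.
  pose I : set R := `[x - N^-1, x + N^-1]%classic.
  have N10 : 0 < N^-1 by rewrite invr_gt0.
  have mI : measurable I by exact: measurable_itv.
  have muI : mu I = (N^-1 *+ 2)%:E.
    rewrite /I lebesgue_measure_itv/= lte_fin ltrD2l gt0_cp ?ltW// -EFinD.
    by congr EFin; rewrite mulr2n; ring.
  pose k1 := a x / 2 * (c / 2 * N); pose k2 := 4 * A / (N * dl ^+ 2).
  have ii (D : set (measurableTypeR R)) : measurable D -> (mu D < +oo)%E -> mu.-integrable
    setT (EFin \o \1_D).
    move=> mD Dy; apply: (bounded_on_integrable mD Dy); split.
    - exact: measurable_indic.
    - by exists 1 => s; rewrite indicE ger0_norm// lern1 leq_b1.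
    - by move=> s Ds; rewrite indicE memNset.
  have j1 : mu.-integrable setT (EFin \o \1_I) by apply: ii; rewrite // muI ltry.
  have j2 : mu.-integrable setT (EFin \o \1_(seg B)).
    by apply: ii; rewrite ?lebesgue_seg_lty//; exact: measurable_seg.
  have i1 : mu.-integrable setT (EFin \o (fun s => k1 * \1_I s)).
    exact: integrableZl j1.
  have i2 : mu.-integrable setT (EFin \o (fun s => k2 * \1_(seg B) s)).
    exact: integrableZl j2.
  have E (D : set (measurableTypeR R)) : measurable D -> \int[mu]_s (\1_D s : R) = fine (mu D).
    by move=> mD; rewrite /Rintegral integral_indic// setIT.
  apply: (@le_trans _ _ (\int[mu]_s (k1 * \1_I s - k2 * \1_(seg B) s))).
    rewrite RintegralB// RintegralZl// RintegralZl//.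
    rewrite (E _ mI) (E _ (measurable_seg B)) muI/= -/V /k1 /k2.
    rewrite le_eqVlt; apply/orP; left; apply/eqP; rewrite -mulr_natr; field.
    by rewrite !gt_eqF.
  have i3 := bounded_on_integrable (measurable_seg B) (lebesgue_seg_lty B) (bounded_inner N0).
  have i12 : mu.-integrable setT (EFin \o (fun s => k1 * \1_I s - k2 * \1_(seg B) s)).
    exact: integrableB i1 i2.
  apply: le_Rintegral => //.
  move=> s _; have k20 : 0 <= k2 by rewrite divr_ge0 ?mulr_ge0 ?exprn_ge0 ?normr_ge0 ?(ltW
    N0) ?(ltW dl0).
  have iB : 0 <= (\1_(seg B) s : R) by rewrite indicE.
  have LI : s \in I = (`|s - x| <= N^-1).
    apply/idP/idP; rewrite inE /I/= in_itv/= ler_norml; first by move=> /andP[? ?];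
      apply/andP; split; lra.
    by move=> /andP[? ?]; apply/andP; split; lra.
  have aK u : u != 0 -> 0 <= fejer_cos N u  by exact: fejer_cos_ge0.
  have [near|far] := ltP `|s - x| dl.
    have as2 : a x / 2 <= a s.
      by have := Hdl _ near; rewrite ler_norml => /andP[]; lra.
    apply: (@le_trans _ _ (k1 * \1_I s)); first by rewrite gerBl mulr_ge0.
    rewrite indicE LI; case: (leP `|s - x| N^-1) => [sN|Ns]; rewrite /= ?mulr1 ?mulr0.
      rewrite /k1; apply: ler_pM => //; first exact: ltW.
        by rewrite mulr_ge0 ?divr_ge0 ?(ltW c0) ?(ltW N0).
      exact: fejer_cos_ge.
    apply: mulr_ge0; first exact: le_trans (ltW ax20) as2.
    by apply: aK; rewrite -normr_gt0; exact: lt_trans Ns.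
  have u0 : s - x != 0 by rewrite -normr_gt0 (lt_le_trans dl0).
  have NI : (s \in I) = false by rewrite LI; apply/negbTE; rewrite -ltNge (lt_le_trans Ndl).
  rewrite [\1_I s]indicE NI/= mulr0 sub0r.
  have [sB|sB] := pselect (seg B s); last first.
    by rewrite indicE memNset// a0//= mulr0 mul0r oppr0.
  rewrite indicE mem_set//= mulr1 lerNl -mulNr.
  apply: (@le_trans _ _ (A * (4 / (N * dl ^+ 2)))); last first.
    by rewrite /k2 mulrCA mulrA.
  apply: (@le_trans _ _ (A * fejer_cos N (s - x))).
    rewrite ler_wpM2r ?aK//.
    by rewrite (le_trans _ (bA s))// -normrN ler_norm.
  rewrite ler_wpM2l ?normr_ge0//.
  - apply: (le_trans (fejer_cos_le N0 u0)); rewrite ler_wpM2l// lef_pV2 ?posrE.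
    + rewrite ler_wpM2l ?(ltW N0)//.
      by rewrite -(real_normK (num_real (s - x))) lerXn2r ?nnegrE ?(ltW dl0).
    + by rewrite mulr_gt0// exprn_even_gt0.
    + by rewrite mulr_gt0// exprn_gt0.
set E := 4 * A * V / dl ^+ 2 in key.
have E0 : 0 <= E by rewrite divr_ge0 ?mulr_ge0 ?exprn_ge0 ?normr_ge0 ?(ltW dl0).
suff : c / 2 * a x <= fine J.
  rewrite -ler_pdivlMl ?divr_gt0// => /le_trans; apply.
  by rewrite invf_div.
apply/ler_addgt0Pr => e e0.
(* Large enough for both [N^-1 < dl] and [E * N^-1 <= e]. *)
pose N := E / e + dl^-1 + 1.
have dV : 0 < dl^-1 by rewrite invr_gt0.
have Ee : 0 <= E / e by rewrite divr_ge0 ?(ltW e0).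
have N0 : 0 < N by rewrite /N; lra.
have Ndl : N^-1 < dl by rewrite invf_plt ?posrE// /N; lra.
rewrite -lerBlDr; apply: le_trans (key _ N0 Ndl); rewrite lerD2l lerN2.
rewrite ler_pdivrMr// /N mulrDr mulrDr mulrCA divff ?gt_eqF// mulr1.
by rewrite -addrA lerDl addr_ge0 ?mulr_ge0 ?(ltW e0) ?(ltW dV).
Qed.

End Bound.

Lemma Rintegral_trigN d (T : measurableType d) (m : {measure set T -> \bar R})
    (D : set T) (mD : measurable D) (mDy : (m D < +oo)%E) (a b h : T -> R) :
  bounded_on D a -> bounded_on D b -> measurable_fun setT h ->
  \int[m]_p (- a p * cos (h p) + - b p * sin (h p)) =
  - \int[m]_p (a p * cos (h p) + b p * sin (h p)).
Proof.
move=> ha hb mh; rewrite -mulN1r -RintegralZl//; last first.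
  by apply: (bounded_on_integrable mD mDy); exact: bounded_on_trig.
by apply: eq_Rintegral => p _; ring.
Qed.

Lemma trig1N a b B t : bounded_on (seg B) a -> bounded_on (seg B) b ->
  trig1 (fun s => - a s) (fun s => - b s) t = - trig1 a b t.
Proof.
move=> ha hb; apply: (Rintegral_trigN (measurable_seg B) (lebesgue_seg_lty B)) => //.
exact: measurable_funM.
Qed.

Lemma trig1_bound a b x B : bounded_on (seg B) a -> bounded_on (seg B) b ->
  (forall e : R, 0 < e -> exists2 dl : R, 0 < dl &
    forall y : R, `|y - x| < dl -> `|a y - a x| <= e) ->
  (`|a x|%:E <= (2 / cos 1)%:E *
    \int[mu]_t (`|trig1 a b t| + `|trig1 b (fun s => - a s) t|)%:E)%E.
Proof.
move=> ha hb ca; have [ax|ax|ax] := ltgtP 0 (a x).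
- by rewrite gtr0_norm//; exact: (trig1_bound_pos ha hb ca ax).
- have ha' := bounded_onN ha; have hb' := bounded_onN hb.
  rewrite ltr0_norm//; have nax : 0 < - a x by rewrite oppr_gt0.
  have cna e : 0 < e -> exists2 dl : R, 0 < dl &
      forall y : R, `|y - x| < dl -> `|- a y - - a x| <= e.
    by move=> /ca[dl dl0 H]; exists dl => // y /H; rewrite -opprD normrN.
  apply: (le_trans (trig1_bound_pos ha' hb' cna nax)).
  rewrite le_eqVlt; apply/orP; left; apply/eqP; congr (_ * _)%E.
  apply: eq_integral => t _; rewrite (trig1N _ ha hb) (trig1N _ hb ha')/=.
  by rewrite !normrN.
- rewrite -ax normr0; apply: mule_ge0.
    by rewrite lee_fin divr_ge0// ltW// cos1_gt0.
  by apply: integral_ge0 => t _; rewrite lee_fin addr_ge0.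
Qed.

End FourierLine.

(** * The bound in several variables, by induction on the dimension *)

Section FourierTuple.
Variable R : realType.
Local Notation T := (measurableTypeR R).
Local Notation leb := (lebesgue_tuple R).
Local Notation mu := (@lebesgue_measure R).

(** Uniform continuity for the sup distance. It implies measurability for the product sigma-algebra
    and is inherited by the transform in one coordinate. *)
Definition unif n (f : n.-tuple T -> R) := forall e : R, 0 < e ->
  exists2 dl : R, 0 < dl & forall s s' : n.-tuple T,
    (forall i, `|(tnth s i : R) - tnth s' i| < dl) -> `|f s - f s'| <= e.

(** The preimage of an open half-line is the union of the rational cubes it contains; there are
    countably many, each measurable for the product sigma-algebra. *)
Lemma measurable_unif n (f : n.-tuple T -> R) : unif f -> measurable_fun setT f.
Proof.
move=> uf; apply: (measurability _ (RGenOInfty.measurableE R)) => //= _ [_] [r] -> <-.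
rewrite setTI.
pose cube (q : n.-tuple rat) (m : nat) : set (n.-tuple T) :=
  [set s | forall i, `|(tnth s i : R) - ratr (tnth q i)| < m.+1%:R^-1].
have mc q m : measurable (cube q m).
  rewrite (_ : cube q m = \bigcap_(i in [set: 'I_n]) ((fun s : n.-tuple T => tnth s i) @^-1`
      `]ratr (tnth q i) - m.+1%:R^-1, ratr (tnth q i) + m.+1%:R^-1[%classic)).
    apply: fin_bigcap_measurable => // i _; rewrite -[X in measurable X]setTI.
    exact: (measurable_tnth i _ (measurable_itv _)).
  apply/seteqP; split => [s H i _|s H i].
    by rewrite /= in_itv/= -ltr_distl.
  by have := H i I; rewrite /= in_itv/= -ltr_distl.
(* Codes that decode to no pair, or to a cube that leaves the preimage, contribute the empty set. *)
pose idx (k : nat) : option (n.-tuple rat * nat) := unpickle k.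
rewrite (_ : f @^-1` _ = \bigcup_k
   (if idx k is Some qm then
      if `[< cube qm.1 qm.2 `<=` f @^-1` `]r, +oo[%classic >] then cube qm.1 qm.2 else set0
    else set0)).
  apply: bigcupT_measurable => k; case: (idx k) => [qm|]; last exact: measurable0.
  by case: ifP => _; [exact: mc|exact: measurable0].
apply/seteqP; split => [s|s [k _]]; last first.
  by case: (idx k) => [qm|//]; case: ifP => // /asboolP; apply.
rewrite /= in_itv/= andbT => rs.
have [|dl dl0 H] := uf ((f s - r) / 2); first by lra.
(* A point of the cube is within twice its radius [1 / (m + 1)] of [s], and this must be less than
   [dl]. *)
pose m := Num.truncn (2 / dl).
have mdl : m.+1%:R^-1 * 2 < dl.
  by rewrite mulrC ltr_pdivrMr// mulrC -ltr_pdivrMr// truncnS_gt.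
have m0 : 0 < m.+1%:R^-1 :> R by rewrite invr_gt0.
have /choice [q Hq] : forall i : 'I_n, exists q : rat, `|(tnth s i : R) - ratr q| < m.+1%:R^-1.
  move=> i; have [|q] := @rat_in_itvoo R (tnth s i - m.+1%:R^-1) (tnth s i + m.+1%:R^-1).
    by rewrite ltrBlDr -addrA ltrDl addr_gt0.
  by rewrite in_itv/= => Hq; exists q; rewrite distrC ltr_distl.
pose qt := [tuple q i | i < n].
have qti i : tnth qt i = q i by rewrite tnth_mktuple.
exists (pickle (qt, m)) => //; rewrite /idx pickleK/=.
case: ifP => [_ i|/asboolP []]; first by rewrite qti.
move=> s' Hs'; rewrite /= in_itv/= andbT.
have : `|f s - f s'| <= (f s - r) / 2.
  apply: H => i; apply: le_lt_trans mdl; rewrite mulr_natr mulr2n.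
  rewrite (le_trans (ler_distD (ratr (q i)) _ _))// lerD//; first exact: ltW.
  by have := Hs' i; rewrite qti distrC => /ltW.
by rewrite ler_norml => /andP[]; lra.
Qed.

Definition dott n (s t : n.-tuple T) : R := \sum_i (tnth s i : R) * tnth t i.

Lemma tnth_tuple_cons0 n (s : n.-tuple T) y : tnth (tuple_cons (s, y)) ord0 = y.
Proof. by []. Qed.

Lemma tnth_tuple_consS n (s : n.-tuple T) y j :
  tnth (tuple_cons (s, y)) (lift ord0 j) = tnth s j.
Proof. by rewrite tnthS. Qed.

Lemma dott_cons n (s t : n.-tuple T) y z :
  dott (tuple_cons (s, y)) (tuple_cons (t, z)) = y * z + dott s t.
Proof.
rewrite /dott big_ord_recl; congr (_ + _).
by apply: eq_bigr => i _; rewrite !tnth_tuple_consS.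
Qed.

Lemma measurable_dott n d (X : measurableType d) (g h : X -> n.-tuple T) :
  measurable_fun setT g -> measurable_fun setT h ->
  measurable_fun setT (fun p => dott (g p) (h p)).
Proof.
move=> mg mh; apply: (@measurable_sum _ _ _ _ _ _ (fun i p => (tnth (g p) i : R
  ) * tnth (h p) i)) => i.
by apply: measurable_funM; apply: (measurableT_comp (measurable_tnth i)).
Qed.

(* [trig a b] and [trig b (- a)] are the real and imaginary parts of the
   Fourier transform of [a + i b]; passing from [(a, b)] to [(b, - a)] is
   multiplication by [- i]. *)
Definition trig n (a b : n.-tuple T -> R) (t : n.-tuple T) : R :=
  \int[leb n]_s (a s * cos (dott s t) + b s * sin (dott s t)).

Lemma measurable_trig_tuple n (a b : n.-tuple T -> R) :
  measurable_fun setT a -> measurable_fun setT b -> measurable_fun setT (trig a b).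
Proof.
move=> ma mb.
apply: (@measurable_Rintegral _ _ _ _ _ (@lebs R n)
  (fun p => a p.2 * cos (dott p.2 p.1) + b p.2 * sin (dott p.2 p.1))).
apply: measurable_trig.
- exact: measurableT_comp.
- exact: measurableT_comp.
- exact: measurable_dott.
Qed.

Lemma bounded_on_trig_tuple n B (a b : n.-tuple T -> R) t :
  bounded_on (box B) a -> bounded_on (box B) b ->
  bounded_on (box B) (fun s => a s * cos (dott s t) + b s * sin (dott s t)).
Proof.
by move=> ha hb; apply: bounded_on_trig => //; exact: measurable_dott.
Qed.

Lemma trigN n B (a b : n.-tuple T -> R) t :
  bounded_on (box B) a -> bounded_on (box B) b ->
  trig (fun s => - a s) (fun s => - b s) t = - trig a b t.
Proof.
move=> ha hb; have mh : measurable_fun setT (fun s : n.-tuple T => dott s t).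
  exact: measurable_dott.
exact: (Rintegral_trigN (measurable_box B) (lebesgue_tuple_box n B) ha hb mh).
Qed.

(* The real part of the Fourier transform of [a + i b] in the first coordinate;
   the imaginary part is [partial b (- a)]. *)
Definition partial n (a b : n.+1.-tuple T -> R) (y : R) (s : n.-tuple T) : R :=
  trig1 (fun z => a (tuple_cons (s, z))) (fun z => b (tuple_cons (s, z))) y.

Section Partial.
Variables (n : nat) (B : R) (a b : n.+1.-tuple T -> R).
Hypotheses (ha : bounded_on (box B) a) (hb : bounded_on (box B) b).

Let F y (s : n.+1.-tuple T) : R :=
  a s * cos ((tnth s ord0 : R) * y) + b s * sin ((tnth s ord0 : R) * y).

Let bF y : bounded_on (box B) (F y).
Proof.
apply: bounded_on_trig => //; apply: measurable_funM => //.
exact: measurable_tnth.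
Qed.

Lemma bounded_on_partial y : bounded_on (box B) (partial a b y).
Proof. exact: bounded_on_fiber_Rintegral (bF y). Qed.

Lemma partialN y s :
  partial (fun s => - a s) (fun s => - b s) y s = - partial a b y s.
Proof.
by apply: (@trig1N _ _ _ B); [exact: bounded_on_fiber ha _|exact: bounded_on_fiber hb _].
Qed.

Hypotheses (ua : unif a) (ub : unif b).

Lemma unif_partial y : unif (partial a b y).
Proof.
move=> e e0; pose V := fine (mu (seg B)); have V0 : 0 <= V by rewrite fine_ge0.
(* Both [a] and [b] contribute [e'] on a segment of length [V]; the added 1 keeps the denominator
   positive when [V = 0]. *)
pose e' := e / (2 * V + 1).
have e'0 : 0 < e' by rewrite divr_gt0//; lra.
have [da da0 Ha] := ua e'0; have [db db0 Hb] := ub e'0.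
exists (Num.min da db); first by rewrite lt_min da0.
move=> s s' ss'; have bi := bounded_on_integrable (measurable_seg B) (lebesgue_seg_lty B).
have bfs := bounded_on_fiber (bF y).
rewrite /partial /trig1 -RintegralB//; [|exact: bi (bfs s)|exact: bi (bfs s')].
apply: (@le_trans _ _ ((2 * e') * V)); last first.
  have V1 : 0 < 2 * V + 1 by lra.
  have -> : 2 * e' * V = e * (2 * V / (2 * V + 1)) by rewrite /e'; field; rewrite gt_eqF.
  by rewrite ler_piMr ?(ltW e0)// ler_pdivrMr//; lra.
apply: (normr_Rintegral_bounded_on (measurable_seg B) (lebesgue_seg_lty B)).
  have [[m1 [A HA] z1] [m2 [A' HA'] z2]] := (bfs s, bfs s'); split.
  - exact: measurable_funB m1 m2.
  - exists (A + A') => z; rewrite (le_trans (ler_normB _ _))// lerD//.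
      exact: HA.
    exact: HA'.
  - by move=> z Bz; apply/eqP; rewrite subr_eq0; apply/eqP;
      exact: etrans (z1 z Bz) (esym (z2 z Bz)).
move=> z; have cl dl : (forall i, `|(tnth s i : R) - tnth s' i| < dl) -> 0 < dl ->
    forall i, `|(tnth (tuple_cons (s, z)) i : R) - tnth (tuple_cons (s', z)) i| < dl.
  move=> H dl0 i; case: (unliftP ord0 i) => [j ->|->].
    by rewrite !tnth_tuple_consS.
  by rewrite !tnth_tuple_cons0 subrr normr0.
have ha' : `|a (tuple_cons (s, z)) - a (tuple_cons (s', z))| <= e'.
  by apply: Ha; apply: cl => // i; rewrite (lt_le_trans (ss' i))// ge_min lexx.
have hb' : `|b (tuple_cons (s, z)) - b (tuple_cons (s', z))| <= e'.
  by apply: Hb; apply: cl => // i; rewrite (lt_le_trans (ss' i))// ge_min lexx orbT.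
set a1 := a _ in ha' *; set a2 := a _ in ha' *; set b1 := b _ in hb' *; set b2 := b _ in hb' *.
rewrite (_ : _ - _ = (a1 - a2) * cos (z * y) + (b1 - b2) * sin (z * y)); last by ring.
rewrite mulr_natl mulr2n (le_trans (ler_normD _ _))// !normrM lerD//.
- by rewrite (le_trans _ ha')// ler_piMr// cos_max.
- by rewrite (le_trans _ hb')// ler_piMr// sin_max.
Qed.

End Partial.

Lemma unifN n (a : n.-tuple T -> R) : unif a -> unif (fun s => - a s).
Proof.
move=> ua e /ua[dl dl0 H]; exists dl => // s s' /H.
by rewrite -opprD normrN.
Qed.

(** Fubini's theorem and the addition formulas: transforming the first coordinate and then the
    others, as complex functions, gives the full transform. *)
Lemma trig_partial n B (a b : n.+1.-tuple T -> R) y t :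
  bounded_on (box B) a -> bounded_on (box B) b ->
  trig (partial a b y) (partial b (fun s => - a s) y) t = trig a b (tuple_cons (t, y)).
Proof.
move=> ha hb; have hna := bounded_onN ha.
have bF := bounded_on_trig_tuple (tuple_cons (t, y)) ha hb.
rewrite {2}/trig (Rintegral_lebesgue_tupleS_fiber bF); apply: eq_Rintegral => s _.
under [RHS]eq_Rintegral do rewrite dott_cons.
have bi := bounded_on_integrable (measurable_seg B) (lebesgue_seg_lty B).
have it (c e : n.+1.-tuple T -> R) : bounded_on (box B) c -> bounded_on (box B) e ->
   mu.-integrable setT (EFin \o (fun z : R => c (tuple_cons (s, z)) * cos (z * y) +
     e (tuple_cons (s, z)) * sin (z * y))).
  move=> hc he; apply: bi; apply: bounded_on_trig.
  - exact: bounded_on_fiber hc s.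
  - exact: bounded_on_fiber he s.
  - exact: measurable_funM.
have i1 := it _ _ ha hb; have i2 := it _ _ hb hna.
set ds := dott s t.
rewrite /partial /trig1 -!RintegralZr// -RintegralD//.
- by apply: eq_Rintegral => z _; rewrite cosD sinD; ring.
- exact: integrableZr i1.
- exact: integrableZr i2.
Qed.

(** The [L^1] norm of the transform up to a factor 2. The sum of the two absolute values is used
    because it is unchanged by multiplication by [- i], which exchanges the parts up to sign. *)
Definition trig_mass n (a b : n.-tuple T -> R) : \bar R :=
  (\int[leb n]_t (`|trig a b t| + `|trig b (fun s => - a s) t|)%:E)%E.

Lemma trig_mass_rot n B (a b : n.-tuple T -> R) :
  bounded_on (box B) a -> bounded_on (box B) b ->
  trig_mass b (fun s => - a s) = trig_mass a b.
Proof.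
move=> ha hb; apply: eq_integral => t _; rewrite (trigN _ ha hb).
by rewrite normrN addrC.
Qed.

Lemma measurable_trig_mass n (a b : n.-tuple T -> R) :
  measurable_fun setT a -> measurable_fun setT b ->
  measurable_fun setT (fun t => (`|trig a b t| + `|trig b (fun s => - a s) t|)%:E).
Proof.
move=> ma mb; apply/measurable_EFinP; apply: measurable_funD; apply: measurableT_comp => //.
  exact: measurable_trig_tuple.
by apply: measurable_trig_tuple => //; exact: measurable_funN.
Qed.

(** The line bound in the first coordinate is followed, at each frequency [z], by the induction
    hypothesis for the partial transform. A coordinate costs [2 / cos 1] from the line and a factor
    2 because both parts of the partial transform are estimated by its mass. *)
Lemma trig_bound n B (a b : n.-tuple T -> R) x :
  unif a -> unif b -> bounded_on (box B) a -> bounded_on (box B) b ->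
  (`|a x|%:E <= ((4 / cos 1) ^+ n)%:E * trig_mass a b)%E.
Proof.
have c0 := @cos1_gt0 R.
elim: n a b x => [|n IH] a b x ua ub ha hb.
  have [ma _ _] := ha; have [mb _ _] := hb.
  (* In dimension 0 the measure is a Dirac mass and the transform of [a + i b] is its only value. *)
  have E : trig a b ([tuple] : 0.-tuple T) = a x.
    have mF : measurable_fun setT (EFin \o (fun s : 0.-tuple T =>
        a s * cos (dott s [tuple]) + b s * sin (dott s [tuple]))).
      by apply/measurable_EFinP; have [] := bounded_on_trig_tuple [tuple] ha hb.
    rewrite /trig /Rintegral [X in fine X](integral_dirac _ measurableT mF).
    by rewrite diracT mul1e /= /dott big_ord0 cos0 sin0 mulr1 mulr0 addr0 (tuple0 x).
  rewrite expr0 mul1e /trig_mass.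
  rewrite [leRHS](integral_dirac _ measurableT (measurable_trig_mass ma mb)).
  by rewrite diracT mul1e lee_fin E lerDl.
have hna := bounded_onN ha; have una := unifN ua.
have [ma _ _] := ha; have [mb _ _] := hb; have [mna _ _] := hna.
have [[x' y] ->] : exists p, x = tuple_cons p.
  exists ([tuple of behead x], thead x).
  by apply: val_inj; rewrite {1}(tuple_eta x).
pose G (t : n.+1.-tuple T) := (`|trig a b t| + `|trig b (fun s => - a s) t|)%:E.
have G0 t : (0 <= G t)%E by rewrite lee_fin addr_ge0.
have mG : measurable_fun setT G by exact: measurable_trig_mass.
have kappa0 : (0 <= (4 / cos 1 : R)%:E)%E by rewrite lee_fin divr_ge0// ltW.
have kn0 : (0 <= ((4 / cos 1 : R) ^+ n)%:E)%E.
  by rewrite lee_fin exprn_ge0// divr_ge0// ltW.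
have mass_slice z : trig_mass (partial a b z) (partial b (fun s => - a s) z) =
    (\int[leb n]_t G (tuple_cons (t, z)))%E.
  apply: eq_integral => t _; rewrite (trig_partial _ _ ha hb) /G.
  rewrite (_ : (fun s => - partial a b z s) = partial (fun s => - a s) (fun s => - b s) z).
    by rewrite (trig_partial _ _ hb hna).
  by apply/funext => s; rewrite (partialN ha hb).
have step z : ((`|partial a b z x'| + `|partial b (fun s => - a s) z x'|)%:E <=
    (2 * (4 / cos 1) ^+ n)%:E * \int[leb n]_t G (tuple_cons (t, z)))%E.
  have hA := bounded_on_partial ha hb z; have hB := bounded_on_partial hb hna z.
  have uA : unif (partial a b z) by exact: unif_partial ha hb ua ub z.
  have uB : unif (partial b (fun s => - a s) z) by exact: unif_partial hb hna ub una z.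
  have IA := IH _ _ x' uA uB hA hB.
  (* The imaginary part is the real part of the pair multiplied by [- i], and that pair has the same
     mass. *)
  have IB := IH _ _ x' uB (unifN uA) hB (bounded_onN hA).
  rewrite (trig_mass_rot hA hB) in IB; rewrite mass_slice in IA IB.
  rewrite EFinD EFinM -muleA mule_natl mule2n; exact: leeD.
have cay (e : R) : 0 < e -> exists2 dl : R, 0 < dl & forall z : R, `|z - y| < dl ->
    `|a (tuple_cons (x', z)) - a (tuple_cons (x', y))| <= e.
  move=> /ua[dl dl0 H]; exists dl => // z zy; apply: H => i.
  case: (unliftP ord0 i) => [j ->|->]; last by rewrite !tnth_tuple_cons0.
  by rewrite !tnth_tuple_consS subrr normr0.
have mP : measurable_fun setT (fun z => \int[leb n]_t G (tuple_cons (t, z)))%E.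
  have mc : measurable_fun setT (G \o @tuple_cons R n).
    exact: measurableT_comp mG (@measurable_tuple_cons R n).
  exact: (@measurable_fun_fubini_tonelli_G _ _ _ _ _ (@lebs R n) (G \o @tuple_cons R n) mc
    (fun z => G0 _)).
have ba := bounded_on_fiber ha x'; have bb := bounded_on_fiber hb x'.
apply: (le_trans (trig1_bound ba bb cay)).
apply: (@le_trans _ _ ((2 / cos 1)%:E * \int[mu]_z
    ((2 * (4 / cos 1) ^+ n)%:E * \int[leb n]_t G (tuple_cons (t, z))))%E).
  apply: lee_wpmul2l; first by rewrite lee_fin divr_ge0// ltW.
  apply: ge0_le_integral => //.
  - have [[mba _ _] [mbb _ _]] := (ba, bb).
    apply/measurable_EFinP; apply: measurable_funD; apply: measurableT_comp => //.
      exact: measurable_trig1.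
    by apply: measurable_trig1 => //; exact: measurable_funN.
  - exact: measurable_funeM.
  - by move=> z _; exact: step.
rewrite ge0_integralZl//; first last.
- by rewrite lee_fin mulr_ge0// -lee_fin.
- by move=> z _; apply: integral_ge0 => t _.
rewrite /trig_mass (integral_lebesgue_tupleS mG G0) muleA -EFinM exprS.
rewrite le_eqVlt; apply/orP; left; apply/eqP; congr (_%:E * _)%E; field.
by rewrite gt_eqF.
Qed.

End FourierTuple.

(** * Fourier transform of derivatives *)

Section CoordinateDerivative.
Variable R : realType.
Local Notation T := (measurableTypeR R).
Local Notation leb := (lebesgue_tuple R).
Local Notation mu := (@lebesgue_measure R).

Definition upd n (s : n.-tuple T) (i : 'I_n) (y : R) : n.-tuple T :=
  [tuple if j == i then y else tnth s j | j < n].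

Lemma upd_cons0 n (s : n.-tuple T) y z :
  upd (tuple_cons (s, z)) ord0 y = tuple_cons (s, y).
Proof.
apply: eq_from_tnth => j; rewrite tnth_mktuple.
case: (unliftP ord0 j) => [k ->|->]; last by rewrite eqxx.
by rewrite -(inj_eq val_inj)/= !tnth_tuple_consS.
Qed.

Lemma upd_consS n (s : n.-tuple T) i y z :
  upd (tuple_cons (s, z)) (lift ord0 i) y = tuple_cons (upd s i y, z).
Proof.
apply: eq_from_tnth => j; rewrite tnth_mktuple.
case: (unliftP ord0 j) => [k ->|->]; last first.
  by rewrite -(inj_eq val_inj)/= !tnth_tuple_cons0.
by rewrite (inj_eq (@lift_inj _ ord0)) !tnth_tuple_consS tnth_mktuple.
Qed.

(** Fubini's theorem separates only the first coordinate; the induction peels coordinates off until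
    [i] comes first, which permits integration by parts in any coordinate. *)
Lemma Rintegral_eq0_coord n B i (H : n.-tuple T -> R) : bounded_on (box B) H ->
  (forall s, \int[mu]_y H (upd s i y) = 0) -> \int[leb n]_s H s = 0.
Proof.
elim: n i H => [[]//|n IH] i H bH H0.
case: (unliftP ord0 i) => [j|] ij; rewrite ij in H0.
- rewrite (Rintegral_lebesgue_tupleS_slice bH).
  rewrite (@eq_Rintegral _ _ _ mu _ (cst 0)) ?Rintegral_cst ?mul0r// => y _.
  apply: (IH j); first exact: bounded_on_slice bH y.
  move=> s; rewrite -[RHS](H0 (tuple_cons (s, y))); apply: eq_Rintegral => z _.
  by rewrite upd_consS.
- rewrite (Rintegral_lebesgue_tupleS_fiber bH).
  rewrite (@eq_Rintegral _ _ _ (leb n) _ (cst 0)) ?Rintegral_cst ?mul0r// => s _.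
  rewrite -[RHS](H0 (tuple_cons (s, 0))); apply: eq_Rintegral => z _.
  by rewrite upd_cons0.
Qed.

Lemma dott_upd n (s t : n.-tuple T) i y :
  dott (upd s i y) t = y * tnth t i + \sum_(j | j != i) (tnth s j : R) * tnth t j.
Proof.
rewrite /dott (bigD1 i)//= tnth_mktuple eqxx; congr (_ + _).
by apply: eq_bigr => j /negbTE ji; rewrite tnth_mktuple ji.
Qed.

Section Coord.
Variables (n : nat) (B : R) (i : 'I_n) (a b a' b' : n.-tuple T -> R).
Hypotheses (ha : bounded_on (box B) a) (hb : bounded_on (box B) b).
Hypotheses (ha' : bounded_on (box B) a') (hb' : bounded_on (box B) b').
Hypothesis da : forall s (y : R), is_derive y 1 (fun z : R => a (upd s i z)) (a' (upd s i y)).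
Hypothesis db : forall s (y : R), is_derive y 1 (fun z : R => b (upd s i z)) (b' (upd s i y)).
Hypothesis ca' : forall s, continuous (fun z : R => a' (upd s i z)).
Hypothesis cb' : forall s, continuous (fun z : R => b' (upd s i z)).

(** The difference of the two sides is the integral of the derivative of [a * cos + b * sin] in the
    coordinate [i]. Along each line this is the derivative of a function of compact support, so its
    integral is zero. *)
Lemma trig_coord t : trig a' b' t = - (tnth t i : R) * trig b (fun s => - a s) t.
Proof.
set ti : R := tnth t i.
have b1 := bounded_on_trig_tuple t ha' hb'.
have b2 := bounded_on_trig_tuple t hb (bounded_onN ha).
have bi := bounded_on_integrable (measurable_box B) (lebesgue_tuple_box n B).
pose H s := (a' s * cos (dott s t) + b' s * sin (dott s t)) +
  ti * (b s * cos (dott s t) + (- a s) * sin (dott s t)).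
have bH : bounded_on (box B) H.
  have [[m1 [A1 H1] z1] [m2 [A2 H2] z2]] := (b1, b2); split.
  - by apply: measurable_funD => //; exact: measurable_funM.
  - exists (A1 + `|ti| * A2) => s; rewrite (le_trans (ler_normD _ _))//.
    by apply: lerD (H1 s) _; rewrite normrM; apply: ler_wpM2l (H2 s).
  - by move=> s Bs; rewrite /H z1// z2// mulr0 addr0.
have H0 : \int[leb n]_s H s = 0.
  apply: (Rintegral_eq0_coord (i := i) bH) => s.
  set c := \sum_(j | j != i) (tnth s j : R) * tnth t j.
  pose h (y : R) : R := H (upd s i y).
  pose G (y : R) : R := a (upd s i y) * cos (y * ti + c) + b (upd s i y) * sin (y * ti + c).
  have hE y : h y = (a' (upd s i y) * cos (y * ti + c) + b' (upd s i y) * sin (y * ti + c)) +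
     ti * (b (upd s i y) * cos (y * ti + c) + (- a (upd s i y)) * sin (y * ti + c)).
    by rewrite /h /H dott_upd.
  have dG (y : R) : is_derive y 1 G (h y).
    have := da s y; have := db s y => dby day.
    rewrite hE /G; apply: is_derive_eq; rewrite /GRing.scale/=; ring.
  have cont (q : R -> R) (q' : R -> R) : (forall y : R
    , is_derive y 1 q (q' y)) -> continuous q.
    move=> dq y; apply: differentiable_continuous; apply/derivable1_diffP.
    by have [] := dq y.
  have cG : continuous G by exact: cont dG.
  have clin : continuous (fun y : R => y * ti + c).
    move=> y; apply: cvgD; last exact: cvg_cst.
    by apply: cvgM; [exact: cvg_id|exact: cvg_cst].
  have ccos : continuous (fun y : R => cos (y * ti + c)).
    by move=> y; exact: (@continuous_comp R R R (fun z : R =>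
      z * ti + c) (@cos R) y (clin y) (@continuous_cos R _)).
  have csin : continuous (fun y : R => sin (y * ti + c)).
    by move=> y; exact: (@continuous_comp R R R (fun z : R =>
      z * ti + c) (@sin R) y (clin y) (@continuous_sin R _)).
  have ch : continuous h.
    rewrite (_ : h = fun y => (a' (upd s i y) * cos (y * ti + c) + b' (upd s i y) * sin (y
      * ti + c)) +
     ti * (b (upd s i y) * cos (y * ti + c) + (- a (upd s i y)) * sin (y * ti + c)));
       last exact/funext.
    move=> y; apply: cvgD; first by apply: cvgD; apply: cvgM;
      [exact: ca'|exact: ccos|exact: cb'|exact: csin].
    apply: cvgM; first exact: cvg_cst.
    apply: cvgD; apply: cvgM; [exact: (cont _ _ (db s))|exact: ccos| |exact: csin].
    by apply: cvgN; exact: (cont _ _ (da s)).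
  (* Strictly larger than [B], so that [G] vanishes at both endpoints, and positive whatever the
     sign of [B]. *)
  pose B1 := `|B| + 1.
  have B10 : - B1 < B1 by rewrite /B1; have := normr_ge0 B; lra.
  have out (q : n.-tuple T -> R) y : bounded_on (box B) q -> B1 <= `|y| -> q (upd s i y) = 0.
    move=> [_ _ q0] By; apply: q0 => /(_ i); rewrite tnth_mktuple eqxx.
    by apply/negP; rewrite -ltNge (lt_le_trans _ By)// /B1; have := ler_norm B; lra.
  have -> : \int[mu]_y H (upd s i y) = \int[mu]_(y in `[- B1, B1]) h y.
    rewrite [RHS]Rintegral_mkcond; apply: eq_Rintegral => y _.
    rewrite patchE; case: ifPn => // /negP yB; rewrite out//.
    rewrite leNgt; apply/negP => /ltW yB1; apply: yB; rewrite inE/= in_itv/=.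
    by rewrite -ler_norml.
  have B1n : `|B1| = B1 by rewrite ger0_norm// /B1 addr_ge0.
  rewrite /Rintegral (@continuous_FTC2 _ h G)//.
  - by rewrite /G !out ?normrN ?B1n//= !mul0r !addr0 subrr.
  - exact: continuous_subspaceT.
  - split.
    + by move=> y _; have [] := dG y.
    + by apply: cvg_at_right_filter; exact: cG.
    + by apply: cvg_at_left_filter; exact: cG.
  - by move=> y _; rewrite derive1E; have [_ ->] := dG y.
have i1 := bi _ b1; have i2 := bi _ b2.
have i2' : (leb n).-integrable setT (EFin \o (fun s =>
  ti * (b s * cos (dott s t) + (- a s) * sin (dott s t)))).
  exact: integrableZl i2.
move: H0; rewrite /H RintegralD// RintegralZl// -!/(trig _ _ _) => /eqP.
by rewrite addr_eq0 mulNr => /eqP.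
Qed.

End Coord.

End CoordinateDerivative.

(** * Continuous functions vanishing outside a box *)

Section CompactSupport.
Variable R : realType.
Local Notation T := (measurableTypeR R).

(** The strict inequality describes an open set of points, so derivatives vanish there as well. *)
Definition vanish n (V : zmodType) (B : R) (g : 'rV[R]_n -> V) :=
  forall x : 'rV[R]_n, (exists i, B < `|x ord0 i|) -> g x = 0.

(** Heine's theorem on the compact box [K], in a form where only one of the two points has to lie in
    [K]; if neither does, both values are zero. *)
Lemma unif_continuous_vanish n B (g : 'rV[R]_n -> R) : continuous g -> vanish B g ->
  unif (fun s : n.-tuple T => g (rowv s)).
Proof.
move=> cg vg e e0.
pose K := [set x : 'rV[R]_n | forall i, `[- B, B]%classic (x ord0 i)].
have cK : compact K by apply: (@rV_compact R n (fun=> `[- B, B]%classic)) => _;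
  exact: segment_compact.
have KP x : ~ K x -> g x = 0.
  move=> Kx; apply: vg; apply: contrapT => H; apply: Kx => i;
    rewrite /= in_itv/= -ler_norml leNgt.
  by apply/negP => Bi; apply: H; exists i.
have e20 : 0 < e / 2 by rewrite divr_gt0.
have [dl [dl0 Hdl]] : exists dl : R, 0 < dl /\
    forall x, K x -> forall y, ball x dl y -> `|g x - g y| <= e.
  pose P (dl : R) (x : 'rV[R]_n) := forall y, ball x dl y -> `|g x - g y| <= e.
  have cover x : K x -> \forall x' \near x & dl \near 0^'+, P dl x'.
    move=> Kx; have := cg x => /cvgr_dist_lt /(_ _ e20) /nbhs_ballP[r0 /= r00 Hr].
    exists (ball x (r0 / 2), [set dl | dl < r0 / 2]).
      split; first by apply: nbhsx_ballx; rewrite divr_gt0.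
      by apply: nbhs_right_lt; rewrite divr_gt0.
    move=> [x' dl] /= [xx' dlr] y x'y.
    have xx'r : ball x r0 x' by apply: le_ball xx'; rewrite ler_pdivrMr// ler_pMr// ler1n.
    have xy : ball x r0 y.
      by rewrite [r0]splitr; apply: ball_triangle xx' _; apply: le_ball x'y; exact: ltW.
    have := Hr _ xx'r; have := Hr _ xy; rewrite /= => h1 h2.
    rewrite (le_trans (ler_distD (g x) _ _))// [leRHS]splitr lerD//; last exact: ltW.
    by rewrite distrC ltW.
  have H := (compact_near_coveringP K).1 cK R (0^'+) P _ cover.
  have [dl [dl0 Hd]] : exists dl, [set dl : R | 0 < dl] dl /\ K `<=` P dl.
    by apply: (@filter_ex _ (0^'+)); apply: filterI; [exact: nbhs_right_gt|exact: H].
  by exists dl; split => // x Kx; exact: Hd.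
exists dl => // s s' ss'.
have bss : ball (rowv s) dl (rowv s').
  by split => // j k; rewrite !mxE; exact: ss'.
have [Ks|Ks] := pselect (K (rowv s)); first exact: Hdl.
have [Ks'|Ks'] := pselect (K (rowv s')).
  by rewrite distrC; apply: Hdl => //; exact: ball_sym.
by rewrite !KP// subrr normr0 ltW.
Qed.

Lemma bounded_on_continuous_vanish n B (g : 'rV[R]_n -> R) : continuous g -> vanish B g ->
  bounded_on (box B) (fun s : n.-tuple T => g (rowv s)).
Proof.
move=> cg vg; split.
- by apply: measurable_unif; exact: unif_continuous_vanish cg vg.
- pose K := [set x : 'rV[R]_n | forall i, `[- B, B]%classic (x ord0 i)].
  have cK : compact K by apply: (@rV_compact R n (fun=> `[- B, B]%classic)) => _;
    exact: segment_compact.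
  have : compact (g @` K) by apply: continuous_compact => //; exact: continuous_subspaceT.
  move=> /compact_bounded[A [_ HA]]; exists (`|A| + 1) => s.
  have [Ks|Ks] := pselect (K (rowv s)).
    by apply: (HA (`|A| + 1)); [rewrite ltr_pwDr// ler_norm|exists (rowv s)].
  rewrite vg ?normr0 ?addr_ge0//; apply: contrapT => H; apply: Ks => i.
  rewrite /= in_itv/= -ler_norml leNgt.
  by apply/negP => Bi; apply: H; exists i.
- move=> s Bs; apply: vg; apply: contrapT => H; apply: Bs => i; rewrite leNgt.
  by apply/negP => Bi; apply: H; exists i; rewrite mxE.
Qed.

End CompactSupport.

(** * Real and imaginary parts, and transforms of iterated differentials *)

Section ComplexValued.
Variables (R : realType) (r : nat).
Local Notation E := 'rV[R]_r.
Local Notation C := (Rcomplex R).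
Local Notation T := (measurableTypeR R).
Implicit Types (f g : E -> C).

Lemma le_normr_Re (z : C) : `|complex.Re z| <= (`|z| : R).
Proof.
case: z => x y; rewrite {2}/Num.norm/= /Normc.normc/= -sqrtr_sqr.
by rewrite ler_wsqrtr// lerDl sqr_ge0.
Qed.

Lemma le_normr_Im (z : C) : `|complex.Im z| <= (`|z| : R).
Proof.
case: z => x y; rewrite {2}/Num.norm/= /Normc.normc/= -sqrtr_sqr.
by rewrite ler_wsqrtr// lerDr sqr_ge0.
Qed.

Lemma le_norm_ReIm (z : C) : (`|z| : R) <= `|complex.Re z| + `|complex.Im z|.
Proof.
case: z => x y; rewrite {1}/Num.norm/= /Normc.normc/=.
rewrite -[leRHS]ger0_norm ?addr_ge0// -sqrtr_sqr ler_wsqrtr//.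
rewrite sqrrD !real_normK ?num_real// -addrA lerD2l lerDr.
by rewrite mulrn_wge0// mulr_ge0.
Qed.

Lemma continuous_Re : continuous (@complex.Re R : C -> R).
Proof.
move=> z A /nbhs_ballP[e /= e0 Ae]; apply/nbhs_ballP; exists e => //= w zw.
apply: Ae; rewrite /ball/= -(linearB (@complex.Re R : {linear C -> R})).
exact: (le_lt_trans (le_normr_Re _) zw).
Qed.

Lemma continuous_Im : continuous (@complex.Im R : C -> R).
Proof.
move=> z A /nbhs_ballP[e /= e0 Ae]; apply/nbhs_ballP; exists e => //= w zw.
apply: Ae; rewrite /ball/= -(linearB (@complex.Im R : {linear C -> R})).
exact: (le_lt_trans (le_normr_Im _) zw).
Qed.

Lemma is_derive_line g (L : {linear C -> R}) (p v : E) (y : R) :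
  continuous L -> differentiable g (p + y *: v) ->
  is_derive y 1 (fun z : R => L (g (p + z *: v))) (L ('d g (p + y *: v) v)).
Proof.
move=> cL dg; have gv : derivable g (p + y *: v) v by exact: diff_derivable.
have cvgL : (fun h : R => h^-1 *: (((fun z => L (g (p + z *: v))) \o shift y) (h *: 1) -
    L (g (p + y *: v)))) @ 0^' --> L ('d g (p + y *: v) v).
  rewrite -(deriveE _ dg) (_ : (fun h => _) = L \o (fun h : R => h^-1 *:
    ((g \o shift (p + y *: v)) (h *: v) - g (p + y *: v)))).
    exact: (continuous_cvg _ (cL _) gv).
  apply/funext => h /=; rewrite [RHS]linearZ [in RHS]linearB/=; congr (_ *: (L (g _) - _)).
  by rewrite /shift/= [h *: 1]mulr1 scalerDl addrCA.
by apply: DeriveDef; [apply/cvg_ex; eexists; exact: cvgL|exact: cvg_lim cvgL].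
Qed.

Lemma rowv_upd (s : r.-tuple T) i y : rowv (upd s i y) = rowv (upd s i 0) + y *: delta_mx 0 i.
Proof.
apply/rowP => j; rewrite !mxE !tnth_mktuple !eqxx/=.
by case: (j == i); rewrite ?mulr1 ?add0r ?mulr0 ?addr0.
Qed.

Lemma vanish_diff B g v : (forall x, differentiable g x) -> vanish B g ->
  vanish B (fun x => 'd g x v).
Proof.
move=> dg vg x [i Bi]; rewrite -deriveE//.
have H : \forall y \near x, g y = cst 0 y.
  have U : nbhs (x ord0 i) [set z : R | B < `|z|].
    have /cvgr_gt := @norm_continuous _ R^o (x ord0 i); exact.
  have := @coord_continuous R 1 r ord0 i x _ U; rewrite nbhs_filterE/=.
  by apply: filterS => y /= By; apply: vg; exists i.
by rewrite (near_eq_derive _ H) derive_cst.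
Qed.

Section Smooth.
Variables (f : E -> C) (B : R).
Hypotheses (sf : smooth f) (vf : vanish B f).

Lemma vanish_frechet vs : vanish B (frechet f vs).
Proof. by elim: vs => [//|v vs IH]; apply: vanish_diff => // x; exact: sf. Qed.

Lemma continuous_frechet vs : continuous (frechet f vs).
Proof. by move=> x; apply: differentiable_continuous; exact: sf. Qed.

Definition Repart vs (s : r.-tuple T) : R := complex.Re (frechet f vs (rowv s)).
Definition Impart vs (s : r.-tuple T) : R := complex.Im (frechet f vs (rowv s)).

Let cRe vs : continuous (fun x => complex.Re (frechet f vs x)).
Proof. by move=> x; apply: continuous_comp; [exact: continuous_frechet|exact:
  continuous_Re]. Qed.

Let cIm vs : continuous (fun x => complex.Im (frechet f vs x)).
Proof. by move=> x; apply: continuous_comp; [exact: continuous_frechet|exact: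
  continuous_Im]. Qed.

Let vRe vs : vanish B (fun x => complex.Re (frechet f vs x)).
Proof. by move=> x xB; rewrite vanish_frechet. Qed.

Let vIm vs : vanish B (fun x => complex.Im (frechet f vs x)).
Proof. by move=> x xB; rewrite vanish_frechet. Qed.

Lemma bounded_on_Re vs : bounded_on (box B) (Repart vs).
Proof. exact: (@bounded_on_continuous_vanish _ _ _ _ (@cRe vs) (@vRe vs)). Qed.

Lemma bounded_on_Im vs : bounded_on (box B) (Impart vs).
Proof. exact: (@bounded_on_continuous_vanish _ _ _ _ (@cIm vs) (@vIm vs)). Qed.

Lemma unif_Re vs : unif (Repart vs).
Proof. exact: (@unif_continuous_vanish _ _ _ _ (@cRe vs) (@vRe vs)). Qed.

Lemma unif_Im vs : unif (Impart vs).
Proof. exact: (@unif_continuous_vanish _ _ _ _ (@cIm vs) (@vIm vs)). Qed.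

Let ReN := fun vs s => - Repart vs s.

Let line_cont (h : E -> R) s i : continuous h ->
  continuous (fun z : R => h (rowv (upd s i z))).
Proof.
move=> ch; rewrite (_ : (fun z => _) = (fun z : R =>
  h (rowv (upd s i 0) + z *: delta_mx 0 i))).
  move=> z; apply: (@continuous_comp R E R (fun z : R =>
    rowv (upd s i 0) + z *: delta_mx 0 i) h).
    apply: cvgD; first exact: cvg_cst.
    exact: scalel_continuous.
  exact: ch.
by apply/funext => z; rewrite rowv_upd.
Qed.

Let derRe vs s i (y : R) : is_derive y 1 (fun z : R => Repart vs (upd s i z))
  (Repart (delta_mx 0 i :: vs) (upd s i y)).
Proof.
rewrite /Repart/=; have E z : rowv (upd s i z) = rowv (upd s i 0) + z *: delta_mx 0 i :=
  rowv_upd s i z.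
rewrite (_ : (fun z => _) = (fun z => complex.Re (frechet f vs (rowv (upd s i 0) + z *:
  delta_mx 0 i)))).
  rewrite (E y).
  exact: (@is_derive_line (frechet f vs) (@complex.Re R : {
    linear C -> R}) _ _ y continuous_Re (sf vs _)).
by apply/funext => z; rewrite (E z).
Qed.

Let derIm vs s i (y : R) : is_derive y 1 (fun z : R => Impart vs (upd s i z))
  (Impart (delta_mx 0 i :: vs) (upd s i y)).
Proof.
rewrite /Impart/=; have E z : rowv (upd s i z) = rowv (upd s i 0) + z *: delta_mx 0 i :=
  rowv_upd s i z.
rewrite (_ : (fun z => _) = (fun z => complex.Im (frechet f vs (rowv (upd s i 0) + z *:
  delta_mx 0 i)))).
  rewrite (E y).
  exact: (@is_derive_line (frechet f vs) (@complex.Im R : {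
    linear C -> R}) _ _ y continuous_Im (sf vs _)).
by apply/funext => z; rewrite (E z).
Qed.

Let tr vs t := trig (Repart vs) (Impart vs) t.
Let tr' vs t := trig (Impart vs) (ReN vs) t.

Let deriv_coord vs i t :
  tr (delta_mx 0 i :: vs) t = - (tnth t i : R) * tr' vs t /\
  tr' (delta_mx 0 i :: vs) t = (tnth t i : R) * tr vs t.
Proof.
split.
  apply: (@trig_coord _ _ B i (Repart vs) (Impart vs)).
  - exact: bounded_on_Re.
  - exact: bounded_on_Im.
  - exact: bounded_on_Re.
  - exact: bounded_on_Im.
  - by move=> s y; exact: derRe.
  - by move=> s y; exact: derIm.
  - by move=> s; exact: (@line_cont (fun x => complex.Re (frechet f (delta_mx 0 i :: vs)
      x)) s i (@cRe _)).
  - by move=> s; exact: (@line_cont (fun x => complex.Im (frechet f (delta_mx 0 i :: vs)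
      x)) s i (@cIm _)).
pose ws := delta_mx 0 i :: vs.
have dReN s (y : R) : is_derive y 1 (fun z : R => ReN vs (upd s i z)) (ReN ws (upd s i y)).
  by have := derRe vs s i y => H; exact: is_deriveN.
have cReN s : continuous (fun z : R => ReN ws (upd s i z)).
  move=> y; apply: cvgN.
  exact: (@line_cont (fun x => complex.Re (frechet f ws x)) s i (@cRe _)).
have cImw s : continuous (fun z : R => Impart ws (upd s i z)).
  exact: (@line_cont (fun x => complex.Im (frechet f ws x)) s i (@cIm _)).
rewrite /tr' (@trig_coord R r B i (Impart vs) (ReN vs) (Impart ws) (ReN ws)
  (bounded_on_Im vs) (bounded_onN (bounded_on_Re vs)) (bounded_on_Im ws)
  (bounded_onN (bounded_on_Re ws)) (fun s y => derIm vs s i y) dReN cImw cReN t).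
by rewrite (trigN _ (bounded_on_Re vs) (bounded_on_Im vs)) mulNr mulrN opprK.
Qed.

Let tr_lin vs (k : R) (u v : E) t :
  tr (k *: u + v :: vs) t = k * tr (u :: vs) t + tr (v :: vs) t /\
  tr' (k *: u + v :: vs) t = k * tr' (u :: vs) t + tr' (v :: vs) t.
Proof.
have bi := bounded_on_integrable (measurable_box B) (lebesgue_tuple_box r B).
have lin (a1 a2 a3 b1 b2 b3 : r.-tuple T -> R) :
    bounded_on (box B) a2 -> bounded_on (box B) a3 ->
    bounded_on (box B) b2 -> bounded_on (box B) b3 ->
    (forall s, a1 s = k * a2 s + a3 s) -> (forall s, b1 s = k * b2 s + b3 s) ->
    trig a1 b1 t = k * trig a2 b2 t + trig a3 b3 t.
  move=> h2 h3 h4 h5 ea eb.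
  have i1 := bi _ (bounded_on_trig_tuple t h2 h4).
  have i2 := bi _ (bounded_on_trig_tuple t h3 h5).
  have i1' : (lebesgue_tuple R r).-integrable setT
      (EFin \o (fun s => k * (a2 s * cos (dott s t) + b2 s * sin (dott s t)))).
    exact: integrableZl i1.
  rewrite /trig -RintegralZl// -RintegralD//.
  by apply: eq_Rintegral => s _; rewrite ea eb; ring.
have eRe s : Repart (k *: u + v :: vs) s = k * Repart (u :: vs) s + Repart (v :: vs) s.
  by rewrite /Repart/= linearP (linearP (@complex.Re R : {linear C -> R})).
have eIm s : Impart (k *: u + v :: vs) s = k * Impart (u :: vs) s + Impart (v :: vs) s.
  by rewrite /Impart/= linearP (linearP (@complex.Im R : {linear C -> R})).
have bRe := bounded_on_Re; have bIm := bounded_on_Im.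
split; apply: lin => //; try exact: bounded_onN.
by move=> s; rewrite /ReN eRe opprD mulrN.
Qed.

(** Differentiation in the direction [v] multiplies the transform by [i <v, t>]. This is known for
    basis vectors, and both sides are linear in [v]. *)
Let deriv v vs t :
  tr (v :: vs) t = - dotr v (rowv t) * tr' vs t /\
  tr' (v :: vs) t = dotr v (rowv t) * tr vs t.
Proof.
pose Q (v : E) := tr (v :: vs) t = - dotr v (rowv t) * tr' vs t /\
  tr' (v :: vs) t = dotr v (rowv t) * tr vs t.
have Qlin k u w : Q u -> Q w -> Q (k *: u + w).
  move=> [u1 u2] [w1 w2]; have [l1 l2] := tr_lin vs k u w t.
  have dl : dotr (k *: u + w) (rowv t) = k * dotr u (rowv t) + dotr w (rowv t).
    rewrite /dotr mulr_sumr -big_split/=; apply: eq_bigr => i _; rewrite !mxE; ring.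
  by split; [rewrite l1 u1 w1 dl|rewrite l2 u2 w2 dl]; ring.
have Q0 : Q 0.
  (* Taking both vectors zero and [k = -1], linearity says that the transform for the direction 0
     equals minus itself plus itself. *)
  have [l1 l2] := tr_lin vs (-1) 0 0 t; rewrite scaler0 addr0 in l1 l2.
  have d0 : dotr 0 (rowv t) = 0 by rewrite /dotr big1// => i _; rewrite mxE mul0r.
  by split; rewrite d0 ?oppr0 mul0r; [move: l1|move: l2]; lra.
have Qi i : Q (delta_mx 0 i).
  have [l1 l2] := deriv_coord vs i t.
  have di : dotr (delta_mx 0 i) (rowv t) = tnth t i.
    rewrite /dotr (bigD1 i)//= big1 ?addr0; first by rewrite !mxE !eqxx mul1r.
    by move=> j /negbTE ji; rewrite !mxE ji mul0r.
  by split; rewrite di.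
rewrite -/(Q v) (row_sum_delta v); apply: (big_ind Q) => //.
- by move=> u w Qu Qw; rewrite -[u]scale1r; exact: Qlin.
- by move=> i _; rewrite -[X in Q X]addr0; exact: Qlin.
Qed.

Definition trig_norm vs t : R := `|trig (Repart vs) (Impart vs) t| +
  `|trig (Impart vs) (fun s => - Repart vs s) t|.

(** Multiplication by [i <v, t>] exchanges the real and imaginary parts up to sign, so the sum of
    their absolute values is multiplied by exactly [|<v, t>|]. *)
Lemma trig_norm_frechet vs t :
  trig_norm vs t = (\prod_(v <- vs) `|dotr v (rowv t)|) * trig_norm [::] t.
Proof.
elim: vs => [|v vs IH]; first by rewrite big_nil mul1r.
rewrite big_cons -mulrA -IH /trig_norm; have [d1 d2] := deriv v vs t.
rewrite -/(tr (v :: vs) t) -/(tr' (v :: vs) t) d1 d2 !normrM normrN mulrDr addrC//.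
Qed.

Lemma trig_norm_le vs (A : R) t : (forall x, (`|frechet f vs x| : R) <= A) ->
  trig_norm vs t <= 4 * A * fine (lebesgue_tuple R r (box B)).
Proof.
move=> HA; set V := fine _; have A0 : 0 <= A := le_trans (normr_ge0 _) (HA 0).
have aux (a b : r.-tuple T -> R) : bounded_on (box B) a -> bounded_on (box B) b ->
    (forall s, `|a s| <= A) -> (forall s, `|b s| <= A) -> `|trig a b t| <= 2 * A * V.
  move=> ha hb bA bB.
  apply: (normr_Rintegral_bounded_on (measurable_box B) (lebesgue_tuple_box r B)).
    exact: bounded_on_trig_tuple.
  move=> s; rewrite mulr_natl mulr2n (le_trans (ler_normD _ _))// !normrM lerD//.
  - by rewrite (le_trans _ (bA s))// ler_piMr// cos_max.
  - by rewrite (le_trans _ (bB s))// ler_piMr// sin_max.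
have bRe s : `|Repart vs s| <= A by apply: le_trans (le_normr_Re _) (HA _).
have bIm s : `|Impart vs s| <= A by apply: le_trans (le_normr_Im _) (HA _).
rewrite (_ : 4 * A * V = 2 * A * V + 2 * A * V); last by ring.
apply: lerD; apply: aux => //; try exact: bounded_on_Re; try exact: bounded_on_Im.
  exact: bounded_onN (bounded_on_Re vs).
by move=> s; rewrite normrN.
Qed.

Lemma frechet_le_trig_mass vs x :
  ((`|frechet f vs x| : R)%:E <= (2 * (4 / cos 1) ^+ r)%:E *
     \int[lebesgue_tuple R r]_t (trig_norm vs t)%:E)%E.
Proof.
have [s ->] : exists s : r.-tuple T, x = rowv s.
  by exists [tuple x ord0 i | i < r]; apply/rowP => i; rewrite mxE tnth_mktuple.
apply: (@le_trans _ _ (`|Repart vs s| + `|Impart vs s|)%:E).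
  by rewrite lee_fin le_norm_ReIm.
have bR := bounded_on_Re vs; have bI := bounded_on_Im vs; have bN := bounded_onN bR.
have uR := unif_Re vs; have uI := unif_Im vs.
have h1 := trig_bound s uR uI bR bI.
have h2 := trig_bound s uI (unifN uR) bI bN.
rewrite (trig_mass_rot bR bI) in h2.
by rewrite EFinD EFinM -muleA mule_natl mule2n; exact: leeD.
Qed.

Lemma measurable_trig_norm vs : measurable_fun setT (trig_norm vs).
Proof.
have [mR _ _] := bounded_on_Re vs; have [mI _ _] := bounded_on_Im vs.
apply: measurable_funD; apply: measurableT_comp => //.
  exact: measurable_trig_tuple.
by apply: measurable_trig_tuple => //; exact: measurable_funN.
Qed.

Lemma fourierE t : fourier f (rowv t) =
  Complex (trig (Repart [::]) (Impart [::]) t)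
          (trig (Impart [::]) (fun s => - Repart [::] s) t).
Proof.
have dE s : dotr (rowv s) (rowv t) = dott s t.
  by apply: eq_bigr => i _; rewrite !mxE.
rewrite /fourier /Cint; congr Complex; apply: eq_Rintegral => s _;
  rewrite /Repart /Impart dE /=; case: (f (rowv s)) => p q /=; ring.
Qed.

Lemma fourier_le t : (`|fourier f (rowv t)| : R) <= trig_norm [::] t.
Proof. by rewrite fourierE; exact: le_norm_ReIm. Qed.

Lemma le_fourier t : trig_norm [::] t <= 2 * (`|fourier f (rowv t)| : R).
Proof.
rewrite fourierE mulr_natl mulr2n /trig_norm; set z : C := Complex _ _.
by apply: lerD; [exact: (le_normr_Re z)|exact: (le_normr_Im z)].
Qed.

Lemma measurable_norm_fourier :
  measurable_fun setT (fun t : r.-tuple T => (`|fourier f (rowv t)| : R)).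
Proof.
have [mR _ _] := bounded_on_Re [::]; have [mI _ _] := bounded_on_Im [::].
rewrite (_ : (fun t => _) = (fun t => Num.sqrt (trig (Repart [::]) (Impart [::]) t ^+ 2 +
    trig (Impart [::]) (fun s => - Repart [::] s) t ^+ 2))); last first.
  by apply/funext => t; rewrite fourierE.
apply: (measurableT_comp (f := @Num.sqrt R)).
  by apply: continuous_measurable_fun; exact: sqrt_continuous.
apply: measurable_funD; apply: measurable_funX.
  exact: measurable_trig_tuple.
by apply: measurable_trig_tuple => //; exact: measurable_funN.
Qed.

End Smooth.

End ComplexValued.

(** * Decay of the Fourier transform and classes of test functions *)

Section IntegrableWeight.
Variable R : realType.
Local Notation T := (measurableTypeR R).
Local Notation leb := (lebesgue_tuple R).
Local Notation mu := (@lebesgue_measure R).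

(** A polynomially decaying weight that factors over the coordinates, so that its integrability
    reduces to that of [1 / (1 + y ^+ 2)] on the line. *)
Definition cauchy n (s : n.-tuple T) : R := \prod_i (oneDsqr (tnth s i : R))^-1.

Lemma cauchy_ge0 n (s : n.-tuple T) : 0 <= cauchy s.
Proof. by apply: prodr_ge0 => i _; rewrite invr_ge0 (le_trans ler01)// oneDsqr_ge1. Qed.

Lemma measurable_cauchy n : measurable_fun setT (@cauchy n).
Proof.
apply: (@measurable_prod _ _ _ _ _ _ (fun i s => (oneDsqr (tnth s i : R))^-1)) => i _.
apply: (measurableT_comp (f := (fun y : R => (oneDsqr y)^-1))).
  exact: continuous_measurable_fun (@continuous_oneDsqrV R).
exact: measurable_tnth.
Qed.

Lemma integral_oneDsqrV : (\int[mu]_y ((oneDsqr y)^-1)%:E < +oo)%E.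
Proof.
rewrite ge0_symfun_integralT.
- rewrite (_ : [set x : R | 0 <= x] = `[0, +oo[%classic); last first.
    by apply/seteqP; split => x; rewrite /= in_itv/= andbT.
  by rewrite integral0y_oneDsqr -EFinM ltry.
- by move=> y; rewrite invr_ge0 (le_trans ler01)// oneDsqr_ge1.
- exact: continuous_oneDsqrV.
- by move=> y /=; rewrite /oneDsqr sqrrN.
Qed.

Lemma integral_cauchy n : (\int[leb n]_s (cauchy s)%:E < +oo)%E.
Proof.
elim: n => [|n IH].
  have mc : measurable_fun setT (EFin \o @cauchy 0).
    by apply/measurable_EFinP; exact: measurable_cauchy.
  by rewrite [ltLHS](integral_dirac _ measurableT mc) diracT mul1e ltry.
rewrite integral_lebesgue_tupleS; last 2 first.
- by apply/measurable_EFinP; exact: measurable_cauchy.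
- by move=> s; rewrite lee_fin cauchy_ge0.
have o0 (y : R) : 0 <= (oneDsqr y)^-1 by rewrite invr_ge0 (le_trans ler01)// oneDsqr_ge1.
have I0 : (0 <= \int[leb n]_s (cauchy s)%:E)%E.
  by apply: integral_ge0 => s _; rewrite lee_fin cauchy_ge0.
have mo : measurable_fun setT (fun y : R => ((oneDsqr y)^-1)%:E).
  by apply/measurable_EFinP; exact: continuous_measurable_fun (@continuous_oneDsqrV R).
have mcn : measurable_fun setT (fun s : n.-tuple T => (cauchy s)%:E).
  by apply/measurable_EFinP; exact: measurable_cauchy.
have o0' (y : R) : (0 <= ((oneDsqr y)^-1)%:E)%E by rewrite lee_fin.
have cn0 (s : n.-tuple T) : (0 <= (cauchy s)%:E)%E by rewrite lee_fin cauchy_ge0.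
rewrite [ltLHS](_ : _ = \int[mu]_y (\int[leb n]_s (cauchy s)%:E * ((oneDsqr y)^-1)%:E))%E.
  rewrite ge0_integralZl//.
  by apply: lte_mul_pinfty => //; [rewrite ge0_fin_numE|exact: integral_oneDsqrV].
apply: eq_integral => y _; rewrite muleC -ge0_integralZl//.
apply: eq_integral => s _; rewrite /cauchy big_ord_recl -EFinM; congr (_ * _)%:E.
by apply: eq_bigr => i _; rewrite tnth_tuple_consS.
Qed.

End IntegrableWeight.

(** * From weighted bounds on derivatives to decay of the transform, and back *)

Section Classes.
Variables (R : realType) (r : nat).
Local Notation E := 'rV[R]_r.
Local Notation C := (Rcomplex R).
Local Notation T := (measurableTypeR R).
Implicit Types (f : E -> C) (W M : nat -> R).

Lemma enorm_ge0 (t : E) : 0 <= enorm t.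
Proof. exact: sqrtr_ge0. Qed.

Lemma dotr_sqr_ge0 (t : E) : 0 <= dotr t t.
Proof. by apply: sumr_ge0 => i _; rewrite -expr2 sqr_ge0. Qed.

Lemma enormE (t : E) : enorm t ^+ 2 = dotr t t.
Proof. by rewrite sqr_sqrtr// dotr_sqr_ge0. Qed.

Lemma dotrZl (k : R) (u v : E) : dotr (k *: u) v = k * dotr u v.
Proof. by rewrite /dotr mulr_sumr; apply: eq_bigr => i _; rewrite mxE mulrA. Qed.

Lemma dotrC (u v : E) : dotr u v = dotr v u.
Proof. by apply: eq_bigr => i _; rewrite mulrC. Qed.

Lemma enormZ (k : R) (u : E) : 0 <= k -> enorm (k *: u) = k * enorm u.
Proof.
by move=> k0; rewrite /enorm dotrZl dotrC dotrZl mulrA -expr2 sqrtrM ?sqr_ge0// sqrtr_sqr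
  ger0_norm.
Qed.

(** Cauchy-Schwarz, from the termwise inequality between geometric and arithmetic means applied to
    [v] and [t / enorm t]. *)
Lemma normr_dotr_le (v t : E) : enorm v <= 1 -> `|dotr v t| <= enorm t.
Proof.
move=> v1; have vv : dotr v v <= 1.
  by rewrite -enormE exprn_ile1// enorm_ge0.
have amgm (u w : E) : `|dotr u w| <= 2^-1 * (dotr u u + dotr w w).
  rewrite /dotr -big_split/= mulr_sumr (le_trans (ler_norm_sum _ _ _))//.
  apply: ler_sum => i _; set p := u _ _; set q := w _ _.
  by rewrite ler_norml; apply/andP; split; have := sqr_ge0 (p + q);
    have := sqr_ge0 (p - q); nra.
have := enorm_ge0 t; rewrite le_eqVlt => /predU1P[t0|t0].
  have tt : dotr t t = 0 by rewrite -enormE -t0 expr0n.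
  have ti i : t ord0 i = 0.
    move/eqP: tt; rewrite psumr_eq0; last by move=> j _; rewrite -expr2 sqr_ge0.
    by move=> /allP/(_ i (mem_index_enum _)); rewrite -expr2 sqrf_eq0 => /eqP.
  by rewrite -t0 /dotr big1 ?normr0// => i _; rewrite ti mulr0.
have tn0 : enorm t != 0 by rewrite gt_eqF.
pose w := (enorm t)^-1 *: t.
have vw : dotr v w = (enorm t)^-1 * dotr v t by rewrite dotrC dotrZl dotrC.
have ww : dotr w w = 1 by rewrite /w dotrZl dotrC dotrZl -enormE; field.
have := amgm v w; rewrite vw ww normrM ger0_norm ?invr_ge0 ?(ltW t0)//.
rewrite ler_pdivrMl// => /le_trans; apply.
by rewrite ler_piMr ?(ltW t0)//; lra.
Qed.

Lemma compact_bounded_rV (K : set E) : compact K ->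
  exists B : R, forall x, K x -> forall i, `|x ord0 i| <= B.
Proof.
move=> /compact_bounded[B [_ HB]]; exists (`|B| + 1) => x Kx i.
have : `|x| <= `|B| + 1 by apply: HB => //; rewrite ltr_pwDr// ler_norm.
apply: le_trans; have /mapP[j Hj ->] : `|x ord0 i| \in [seq `|x p.1 p.2| | p : 'I_1 * 'I_r].
  by apply/mapP; exists (ord0, i) => //=; rewrite mem_enum.
by rewrite [leRHS]/Num.Def.normr /= mx_normrE; apply/bigmax_geP; right => /=; exists j.
Qed.

Lemma test_functions_vanish U f : test_functions U f -> exists B : R, vanish B f.
Proof.
move=> [_ [K [cK _ sK]]]; have [B HB] := compact_bounded_rV cK.
exists B => x [i Bi]; apply/eqP; apply: contraPT Bi => fx.
apply/negP; rewrite -leNgt; apply: HB; apply: sK.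
exact: subset_closure.
Qed.

(** A common form, free of extended reals, for finiteness of both kinds of weighted norms on the
    whole space; inclusions then become comparisons of sequences [W]. *)
Definition dominated f W := exists c : R, forall k (vs : k.-tuple E) x,
  (forall i, enorm (tnth vs i) <= 1) -> (`|frechet f vs x| : R) <= c * W k.

Lemma wnorm_ltyP W f : (forall k, 0 < W k) ->
  (wnorm W setT f < +oo)%E <-> dominated f W.
Proof.
move=> W0; split=> [Wf|[c Hc]].
  have le k (vs : k.-tuple E) x : (forall i, enorm (tnth vs i) <= 1) ->
      (((`|frechet f vs x| : R) / W k)%:E <= wnorm W setT f)%E.
    move=> vs1; apply: (@le_trans _ _ (opnorm f k x * ((W k)^-1)%:E)%E).
      rewrite EFinM; apply: lee_wpmul2r; first by rewrite lee_fin invr_ge0 ltW.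
      by apply: ereal_sup_ubound; exists vs.
    by apply: ereal_sup_ubound; exists k => //; exists x.
  exists (fine (wnorm W setT f)) => k vs x vs1.
  have L := le k vs x vs1; rewrite -ler_pdivrMr// -lee_fin fineK//.
  rewrite ge0_fin_numE//; apply: le_trans L.
  by rewrite lee_fin divr_ge0 ?(ltW (W0 k))//.
apply: (@le_lt_trans _ _ c%:E); last exact: ltry.
apply: ge_ereal_sup => _ [k _ [x _ <-]].
rewrite -lee_pdivlMr ?invr_gt0//.
apply: ge_ereal_sup => _ [vs vs1 <-].
by rewrite -EFinM lee_fin invrK Hc.
Qed.

Lemma dominated_le W W' (D : R) f : (forall k, 0 <= W k) ->
  (forall k, W k <= D * W' k) -> dominated f W -> dominated f W'.
Proof.
move=> W0 WW' [c Hc]; exists (`|c| * D) => k vs x vs1.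
rewrite (le_trans (Hc _ _ _ vs1))// -mulrA (le_trans _ (ler_wpM2l (normr_ge0 c) (WW' k)))//.
by rewrite ler_wpM2r// ler_norm.
Qed.

Lemma measurable_enorm : measurable_fun setT (fun t : r.-tuple T => enorm (rowv t)).
Proof.
rewrite (_ : (fun t => _) = (fun t : r.-tuple T => Num.sqrt (dott t t))); last first.
  by apply/funext => t; congr Num.sqrt; apply: eq_bigr => i _; rewrite !mxE.
apply: (measurableT_comp (f := @Num.sqrt R)).
  by apply: continuous_measurable_fun; exact: sqrt_continuous.
exact: measurable_dott.
Qed.

(** Monotonicity of [omega M] is known on nonnegative reals; [Num.max 0] extends it to the line
    without changing the values taken here. *)
Lemma measurable_omega M : LC M ->
  measurable_fun setT (fun t : r.-tuple T => omega M (enorm (rowv t))).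
Proof.
move=> hM; rewrite (_ : (fun t => _) =
    (fun u => omega M (Num.max 0 u)) \o (fun t : r.-tuple T => enorm (rowv t))); last first.
  by apply/funext => t /=; rewrite max_r// enorm_ge0.
apply: measurableT_comp measurable_enorm.
apply: nondecreasing_measurable => // u v uv.
apply: le_omega => //; first by rewrite le_max lexx.
by rewrite ge_max !le_max lexx uv orbT.
Qed.

Lemma measurable_normhat_integrand M h f B : LC M -> smooth f -> vanish B f ->
  measurable_fun setT (fun t : r.-tuple T =>
    (`|fourier f (rowv t)| : R) * expR (h * omega M (enorm (rowv t)))).
Proof.
move=> hM sf vf; apply: measurable_funM; first exact: measurable_norm_fourier sf vf.
apply: (measurableT_comp (f := @expR R)) => //.
by apply: measurable_funM => //; exact: measurable_omega.
Qed.

(* Uses the derivative of order [k] in the direction of [t]. *)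
Lemma fourier_decay f B M (h : R) : smooth f -> vanish B f -> LC M -> 0 < h ->
  dominated f (fun k => h ^+ k * M k) ->
  exists A : R, forall t : r.-tuple T,
    (`|fourier f (rowv t)| : R) * expR (omega M (enorm (rowv t) / h)) <= A.
Proof.
move=> sf vf hM h0 [c Hc]; pose V := fine (lebesgue_tuple R r (box B)).
have V0 : 0 <= V by rewrite fine_ge0.
exists (4 * `|c| * V) => t; set A := 4 * `|c| * V; set S := trig_norm f [::] t.
have A0 : 0 <= A by rewrite !mulr_ge0.
have S0 : 0 <= S by rewrite addr_ge0.
have th0 : 0 <= enorm (rowv t) / h by rewrite divr_ge0 ?enorm_ge0// ltW.
have Sk k : S * (enorm (rowv t) / h) ^+ k <= A * M k.
  (* At [t = 0] there is no unit direction, but only [k = 0] has a nonzero left side. *)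
  have [t0|t0] := eqVneq (enorm (rowv t)) 0.
    case: k => [|k]; last by rewrite t0 mul0r expr0n/= mulr0 mulr_ge0 ?(ltW (LC_gt0 _ hM)).
    have bd x : (`|frechet f [::] x| : R) <= `|c| * M 0%N.
      have H := Hc 0%N [tuple] x; rewrite expr0 mul1r in H.
      rewrite (le_trans (H _))//; first by case.
      by apply: ler_wpM2r (ler_norm c); rewrite ltW// LC_gt0.
    rewrite expr0 mulr1; apply: (le_trans (trig_norm_le sf vf t bd)).
    by rewrite -/V /A le_eqVlt; apply/orP; left; apply/eqP; ring.
  have tp : 0 < enorm (rowv t) by rewrite lt_neqAle eq_sym t0 enorm_ge0.
  pose u := (enorm (rowv t))^-1 *: rowv t.
  have u1 : enorm u = 1 by rewrite enormZ ?invr_ge0 ?(ltW tp)// mulVf.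
  have ut : dotr u (rowv t) = enorm (rowv t).
    by rewrite dotrZl -enormE expr2 mulrA mulVf// mul1r.
  have bd x : (`|frechet f (nseq k u) x| : R) <= `|c| * (h ^+ k * M k).
    have := Hc k [tuple of nseq k u] x; move=> H; rewrite (le_trans (H _))//.
      by move=> i; rewrite (tnth_nth 0) nth_nseq ltn_ord u1.
    by rewrite ler_wpM2r ?ler_norm// mulr_ge0 ?exprn_ge0 ?(ltW h0)// ltW// LC_gt0.
  have := trig_norm_le sf vf t bd; rewrite (trig_norm_frechet sf vf) -/S -/V.
  have -> : \prod_(v <- nseq k u) `|dotr v (rowv t)| = enorm (rowv t) ^+ k.
    by rewrite big_nseq ut ger0_norm ?enorm_ge0//; elim: k {bd} => //= k ->; rewrite exprS.
  move=> H; rewrite expr_div_n mulrA ler_pdivrMr ?exprn_gt0// mulrC (le_trans H)//.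
  by rewrite /A le_eqVlt; apply/orP; left; apply/eqP; ring.
apply: (@le_trans _ _ (S * expR (omega M (enorm (rowv t) / h)))).
  by rewrite ler_wpM2r ?expR_ge0// fourier_le.
move: S0; rewrite le_eqVlt => /predU1P[<-|S0]; first by rewrite mul0r.
(* Together these inequalities say that [omega M (enorm t / h) <= ln (A / S)], which is the
   optimization over [k]. *)
have SA k : (enorm (rowv t) / h) ^+ k <= A / S * M k by rewrite mulrAC ler_pdivlMr// mulrC.
have AS0 : 0 < A / S.
  have := SA 0%N; rewrite expr0 => H; have := lt_le_trans ltr01 H.
  by rewrite pmulr_lgt0// LC_gt0.
rewrite mulrC -ler_pdivlMr// -[leRHS]lnK ?posrE// ler_expR.
by apply/omega_leP => // p; rewrite lnK ?posrE.
Qed.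

(** Half of [omega] beats the power needed: with [u = enorm t], the square root of [u ^+ (4 * r) <=
    expR (omega M u) * M (4 * r)] controls [u ^+ (2 * r)]. The reciprocal of [cauchy t] is at most
    [(1 + u ^+ 2) ^+ r], hence at most [2 ^+ r] times 1 or [u ^+ (2 * r)]; this is the origin of
    [K]. *)
Lemma normhat_lty f B M h (A : R) : smooth f -> vanish B f -> LC M ->
  (forall t : r.-tuple T, (`|fourier f (rowv t)| : R) * expR (h * omega M (enorm (rowv t)))
     <= A * expR (- (2^-1 * omega M (enorm (rowv t))))) ->
  (normhat M h f < +oo)%E.
Proof.
move=> sf vf hM HA; pose K := 2 ^+ r * Num.sqrt (M (4 * r)%N).
have M1 k := LC_ge1 k hM; have M0 k := LC_gt0 k hM.
have s1 : 1 <= Num.sqrt (M (4 * r)%N) by rewrite -[leLHS]sqrtr1 ler_wsqrtr.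
have Kbound (t : r.-tuple T) : expR (- (2^-1 * omega M (enorm (rowv t)))) <= K * cauchy t.
  set u := enorm (rowv t); have u0 : 0 <= u := enorm_ge0 _.
  have P0 : 0 < \prod_(i < r) oneDsqr (tnth t i : R).
    by apply: prodr_gt0 => i _; rewrite (lt_le_trans ltr01)// oneDsqr_ge1.
  have -> : cauchy t = (\prod_(i < r) oneDsqr (tnth t i : R))^-1 by rewrite /cauchy prodfV.
  rewrite expRN ler_pdivlMr// ler_pdivrMl ?expR_gt0//.
  apply: (@le_trans _ _ ((1 + u ^+ 2) ^+ r)).
    rewrite -[X in _ ^+ X]card_ord -prodr_const; apply: ler_prod => i _.
    rewrite (le_trans ler01) ?oneDsqr_ge1//= /oneDsqr lerD2l /u enormE /dotr (bigD1 i)//=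
      !mxE expr2.
    by rewrite lerDl sumr_ge0// => j _; rewrite -expr2 sqr_ge0.
  have [u1|u1] := leP u 1.
    apply: (@le_trans _ _ (2 ^+ r)).
      apply: lerXn2r; rewrite ?nnegrE ?addr_ge0 ?sqr_ge0//.
      by have := exprn_ile1 2 u0 u1; lra.
    rewrite /K mulrCA ler_peMr ?exprn_ge0// mulr_ege1//.
    by rewrite -{1}expR0 ler_expR mulr_ge0 ?omega_ge0.
  apply: (@le_trans _ _ (2 ^+ r * u ^+ (2 * r))).
    rewrite exprM -exprMn; apply: lerXn2r; rewrite ?nnegrE ?addr_ge0 ?mulr_ge0 ?sqr_ge0//.
    by have : 1 <= u ^+ 2 by [rewrite exprn_ege1// ltW|]; lra.
  rewrite /K mulrCA ler_wpM2l ?exprn_ge0//.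
  have := exprn_le_omega (4 * r) hM u0.
  rewrite (_ : (4 * r = 2 * r * 2)%N); last by rewrite mulnAC.
  rewrite exprM => /ler_wsqrtr; rewrite sqrtr_sqr ger0_norm ?exprn_ge0//.
  rewrite sqrtrM ?expR_ge0// => /le_trans; apply; rewrite ler_wpM2r ?sqrtr_ge0//.
  rewrite -[leRHS]ger0_norm ?expR_ge0// -sqrtr_sqr ler_wsqrtr// -expRM_natl ler_expR.
  by rewrite mulrA divff ?mul1r.
have A0 : 0 <= A.
  have := HA [tuple 0 | i < r]; rewrite -(pmulr_lge0 _ (expR_gt0 (- (2^-1 * omega M
    (enorm (rowv [tuple (0 : R) | i < r])))))); apply: le_trans.
  by rewrite mulr_ge0 ?expR_ge0.
apply: (@le_lt_trans _ _ (\int[lebesgue_tuple R r]_t ((A * K) * cauchy t)%:E)%E).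
  apply: ge0_le_integral => //.
  - by apply/measurable_EFinP; exact: measurable_normhat_integrand sf vf.
  - by apply/measurable_EFinP; apply: measurable_funM => //; exact: measurable_cauchy.
  - move=> t _; rewrite lee_fin (le_trans (HA t))// -mulrA ler_wpM2l//.
under eq_integral do rewrite EFinM.
have K0 : 0 <= K by rewrite mulr_ge0 ?exprn_ge0 ?sqrtr_ge0.
rewrite ge0_integralZl//; last 3 first.
- by apply/measurable_EFinP; exact: measurable_cauchy.
- by move=> t _; rewrite lee_fin cauchy_ge0.
- by rewrite lee_fin mulr_ge0.
by apply: lte_mul_pinfty => //; [rewrite lee_fin mulr_ge0|exact: integral_cauchy].
Qed.

Lemma normhat_dominated f B M h : smooth f -> vanish B f -> LC M -> 0 < h ->
  (normhat M h f < +oo)%E ->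
  dominated f (fun k => expR (h * phi_star (omega M) (h^-1 * k%:R))).
Proof.
move=> sf vf hM h0 fin.
have J0 : (0 <= normhat M h f)%E.
  by apply: integral_ge0 => t _; rewrite lee_fin mulr_ge0 ?expR_ge0.
have Jfin : normhat M h f \is a fin_num by rewrite ge0_fin_numE.
have c0 : 0 <= 4 / cos 1 :> R by rewrite divr_ge0// ltW// cos1_gt0.
pose K : R := 2 * (4 / cos 1) ^+ r; have K0 : 0 <= K by rewrite mulr_ge0// exprn_ge0.
(* [K] passes from the derivative to the mass of its transform, and the factor 2 from the sum of the
   absolute values of the two parts to the modulus. *)
exists (K * (2 * fine (normhat M h f))) => k vs x vs1; set W := expR _.
rewrite -lee_fin; apply: (le_trans (frechet_le_trig_mass sf vf vs x)); rewrite -/K.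
have -> : (K * (2 * fine (normhat M h f)) * W)%:E = (K%:E * ((W * 2)%:E * normhat M h f))%E.
  by rewrite -[in RHS](fineK Jfin) -!EFinM; congr EFin; ring.
apply: lee_wpmul2l; first by rewrite lee_fin.
have W0 : 0 <= W by exact: expR_ge0.
have mI : measurable_fun setT (fun t : r.-tuple T =>
    ((`|fourier f (rowv t)| : R) * expR (h * omega M (enorm (rowv t))))%:E).
  by apply/measurable_EFinP; exact: measurable_normhat_integrand sf vf.
have I0 (t : r.-tuple T) :
    (0 <= ((`|fourier f (rowv t)| : R) * expR (h * omega M (enorm (rowv t))))%:E)%E.
  by rewrite lee_fin mulr_ge0 ?expR_ge0.
have W20 : (0 <= (W * 2)%:E)%E by rewrite lee_fin mulr_ge0.
rewrite /normhat -ge0_integralZl//.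
apply: ge0_le_integral => //.
- by move=> t _; rewrite lee_fin addr_ge0.
- by apply/measurable_EFinP; exact: measurable_trig_norm sf vf _.
- exact: measurable_funeM.
move=> t _; rewrite -EFinM lee_fin (trig_norm_frechet sf vf).
set e := expR (h * omega _ _).
have P : \prod_(v <- vs) `|dotr v (rowv t)| <= W * e.
  apply: (@le_trans _ _ (enorm (rowv t) ^+ k)); last first.
    by apply: exprn_le_phi_star => //; exact: enorm_ge0.
  rewrite big_tuple -[X in _ ^+ X]card_ord -prodr_const; apply: ler_prod => i _.
  by rewrite normr_ge0/= normr_dotr_le.
apply: (@le_trans _ _ ((W * e) * (2 * (`|fourier f (rowv t)| : R)))).
  apply: ler_pM => //; [exact: prodr_ge0|by rewrite addr_ge0|].
  exact: le_fourier.
by rewrite le_eqVlt; apply/orP; left; apply/eqP; ring.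
Qed.

End Classes.

(** * Comparison of the classes *)

Section Inclusions.
Variables (R : realType) (r : nat).
Local Notation E := 'rV[R]_r.
Local Notation C := (Rcomplex R).
Implicit Types (f : E -> C) (M N : nat -> R).

Lemma normM_ltyP M h f : LC M -> 0 < h ->
  (normM M setT h f < +oo)%E <-> dominated f (fun k => h ^+ k * M k).
Proof.
by move=> hM h0; apply: wnorm_ltyP => k; rewrite mulr_gt0 ?exprn_gt0 ?(LC_gt0 _ hM).
Qed.

Lemma normomega_ltyP M l f :
  (normomega (omega M) setT l f < +oo)%E <->
  dominated f (fun k => expR (l^-1 * phi_star (omega M) (l * k%:R))).
Proof. by apply: wnorm_ltyP => k; exact: expR_gt0. Qed.

Lemma le_expR_phi_star1 M k : LC M -> M k <= expR (1^-1 * phi_star (omega M) (1 * k%:R)).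
Proof.
move=> hM.
have H : M k <= 1 ^+ k * expR (1^-1 * phi_star (omega M) (1 * k%:R)).
  by apply: expR_phi_star_ge => // t _; rewrite !mul1r.
by rewrite expr1n [leRHS]mul1r in H.
Qed.

Lemma expR_phi_star1_le M k : LC M -> expR (1^-1 * phi_star (omega M) (1 * k%:R)) <= M k.
Proof.
move=> hM.
have H : expR (1^-1 * phi_star (omega M) (1 * k%:R)) <= 1 ^+ k * M k.
  by apply: expR_phi_star_le => // t _; rewrite !mul1r.
by rewrite expr1n [leRHS]mul1r in H.
Qed.

(** [h'] is the exponent wanted and [2^-1] the share spent on convergence of the integral; the decay
    [omega N (t / h)] has to cover their sum. *)
Lemma dominated_normhat M N U h h' f : LC M -> LC N -> test_functions U f ->
  0 < h -> dominated f (fun k => h ^+ k * N k) ->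
  (forall t, 0 <= t -> (h' + 2^-1) * omega M t <= omega N (t / h)) ->
  (normhat M h' f < +oo)%E.
Proof.
move=> hM hN tf h0 Hf MN; have [B vf] := test_functions_vanish tf; have [sf _] := tf.
have [A HA] := fourier_decay sf vf hN h0 Hf.
apply: (normhat_lty (A := A) sf vf hM) => t.
rewrite expRN ler_pdivlMr ?expR_gt0// -mulrA -expRD -mulrDl.
apply: le_trans (HA t); rewrite ler_wpM2l// ler_expR.
by apply: MN; exact: enorm_ge0.
Qed.

End Inclusions.

(** In the Roumieu case the estimate is given at some index, and a weaker one is produced at an
    index found for it. In the Beurling case the target index and parameter are given, and the
    estimate is read at an index and parameter chosen to suit them. *)
Theorem theorem5p1 (R : realType) (r : nat) (d : Order.disp_t)
    (L : porderType d) (M : L -> nat -> R) (U : set 'rV[R]_r)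
    (hM : standard_weight_matrix M) (hU : open U) (hU0 : U !=set0) :
  ((forall (C : R) (x : L), 0 < C ->
      exists D : R, exists y : L, 0 < D /\
        forall k, C ^+ k * M x k <= D * M y k) ->
   (forall x : L, exists C : R, exists y1 y2 : L, 0 < C /\
      forall j k, M x (j + k)%N <= C ^+ (j + k) * M y1 j * M y2 k) ->
   nonquasianalytic (E_R r M) ->
   D_R M U = Domega_R M U /\ Domega_R M U = Dhat_R M U)
  /\
  ((forall (C : R) (x : L), 0 < C ->
      exists D : R, exists y : L, 0 < D /\
        forall k, C ^+ k * M y k <= D * M x k) ->
   (forall x1 x2 : L, exists C : R, exists y : L, 0 < C /\
      forall j k, M y (j + k)%N <= C ^+ (j + k) * M x1 j * M x2 k) ->
   nonquasianalytic (E_B r M) ->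
   D_B M U = Domega_B M U /\ Domega_B M U = Dhat_B M U).
Proof.
have [_ _ hLC _] := hM.
have Mge0 x h k : 0 < h -> 0 <= h ^+ k * M x k.
  by move=> h0; rewrite mulr_ge0 ?exprn_ge0 ?(ltW h0)// ltW// LC_gt0.
split=> [cond1 cond2 _|cond1 cond2 _].
- have D_Om : D_R M U `<=` Domega_R M U.
    move=> f [tf [x [h h0 /(normM_ltyP f (hLC x) h0) Hf]]]; split => //.
    (* Condition (i) with constant [h] absorbs [h ^+ k]; the conjugate weight with [l = 1] is then
       [M y] itself. *)
    have [D [y [D0 Hy]]] := cond1 h x h0; exists y, 1 => //.
    apply/normomega_ltyP; apply: (dominated_le (D := D) _ _ Hf) => k; first exact: Mge0.
    by rewrite (le_trans (Hy k))// ler_wpM2l ?(ltW D0)// le_expR_phi_star1.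
  have Om_D : Domega_R M U `<=` D_R M U.
    move=> f [tf [x [l l0 /normomega_ltyP Hf]]]; split => //.
    have [C C1 [y Hy]] := omega_iter_R hM cond2 l x.
    have C0 : 0 < C := lt_le_trans ltr01 C1.
    exists y, C => //; apply/(normM_ltyP f (hLC y) C0).
    apply: (dominated_le (D := 1) _ _ Hf) => k; first exact: expR_ge0.
    by rewrite mul1r; exact: expR_phi_star_le.
  have D_hat : D_R M U `<=` Dhat_R M U.
    move=> f [tf [x [h h0 /(normM_ltyP f (hLC x) h0) Hf]]]; split => //.
    (* Once [h] is normalized to 1 the decay is [expR (- omega (M y))]: one half serves the norm,
       the other the convergence. *)
    have [D [y [D0 Hy]]] := cond1 h x h0; exists y, 2^-1 => //.
    apply: (dominated_normhat (N := M y) (h := 1) (hLC y) (hLC y) tf ltr01).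
      apply: (dominated_le (D := D) _ _ Hf) => k; first exact: Mge0.
      by rewrite expr1n mul1r.
    by move=> t _; rewrite divr1 (_ : 2^-1 + 2^-1 = 1) ?mul1r//; lra.
  have hat_Om : Dhat_R M U `<=` Domega_R M U.
    move=> f [tf [x [h h0 Hf]]]; split => //; have [B vf] := test_functions_vanish tf.
    exists x, h^-1; first by rewrite invr_gt0.
    by apply/normomega_ltyP; rewrite invrK; exact: normhat_dominated tf.1 vf (hLC x) h0 Hf.
  (* The inclusion of [Domega_R] in [Dhat_R] passes through [D_R]. *)
  by split; apply/seteqP; split => // f /Om_D/D_hat.
- have D_Om : D_B M U `<=` Domega_B M U.
    move=> f [tf Hf]; split => // x l l0.
    have [C C1 [y Hy]] := omega_iter_B hM cond2 l^-1 x.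
    have C0 : 0 < C := lt_le_trans ltr01 C1.
    have CV0 : 0 < C^-1 by rewrite invr_gt0.
    (* The parameter [C^-1] is chosen to cancel the factor [C ^+ k] caused by the dilation. *)
    have /(normM_ltyP f (hLC y) CV0) Hfy := Hf y _ CV0.
    apply/normomega_ltyP; apply: (dominated_le (D := 1) _ _ Hfy) => k; first exact: Mge0.
    rewrite mul1r exprVn ler_pdivrMl ?exprn_gt0//.
    apply: expR_phi_star_ge => // t t0.
    by rewrite -ler_pdivrMl// Hy.
  have Om_D : Domega_B M U `<=` D_B M U.
    move=> f [tf Hf]; split => // x h h0; have hV0 : 0 < h^-1 by rewrite invr_gt0.
    (* With constant [h^-1], condition (i) becomes [M y k <= D * h ^+ k * M x k], so the estimate at
       [y] with [l = 1] is enough. *)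
    have [D [y [D0 Hy]]] := cond1 _ x hV0.
    have /normomega_ltyP Hfy := Hf y 1 ltr01.
    apply/(normM_ltyP f (hLC x) h0).
    apply: (dominated_le (D := D) _ _ Hfy) => k; first exact: expR_ge0.
    apply: (le_trans (expR_phi_star1_le k (hLC y))).
    have := Hy k; rewrite exprVn ler_pdivrMl ?exprn_gt0// => /le_trans; apply.
    by rewrite mulrCA.
  have D_hat : D_B M U `<=` Dhat_B M U.
    move=> f [tf Hf]; split => // x h h0.
    have [C C1 [y Hy]] := omega_iter_B hM cond2 (h + 2^-1) x.
    have C0 : 0 < C := lt_le_trans ltr01 C1.
    have CV0 : 0 < C^-1 by rewrite invr_gt0.
    have /(normM_ltyP f (hLC y) CV0) Hfy := Hf y _ CV0.
    apply: (dominated_normhat (hLC x) (hLC y) tf CV0 Hfy) => t t0.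
    by rewrite invrK mulrC [t * C]mulrC mulrC Hy.
  have hat_Om : Dhat_B M U `<=` Domega_B M U.
    move=> f [tf Hf]; split => // x l l0; have [B vf] := test_functions_vanish tf.
    have lV0 : 0 < l^-1 by rewrite invr_gt0.
    have := normhat_dominated tf.1 vf (hLC x) lV0 (Hf x _ lV0).
    by rewrite invrK => H; apply/normomega_ltyP.
  by split; apply/seteqP; split => // f /Om_D/D_hat.
Qed.
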